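(* Let $\nu\in\mathcal P_f$. Then $\nu$ is invariant for the process $(X_t,Y_t)_{t\ge0}$ if and only if its $D$-transform $$\hat\nu(n,m)=\int D(n,m;x,y)\,\nu(dx\,dy)$$ is harmonic for the dual process, i.e. if and only if $$\widehat{\mathbb E}_{n,m}\,\hat\nu(N_t,M_t)=\hat\nu(n,m)\qquad\text{for all } n,m\in\mathbb N \text{ and all } t>0.$$ In particular, for every $\theta>0$ the product measure $\nu_\theta(dx\,dy)=\nu_\theta(dx)\,\nu_\theta(dy)$ is invariant for the process $(X_t,Y_t)_{t\ge0}$.
   Context: $\mathbb N=\{0,1,2,\dots\}$. Continuous process: $(X_t,Y_t)_{t\ge 0}$ is the continuous-time Markov jump process on $[0,\infty)^2$ with generator $$Lf(x,y)=\int_0^1\int_0^1\big(f(x(1-u)+yv,\;y(1-v)+xu)-f(x,y)\big)\,du\,dv.$$ Discrete (dual) process: $(N_t,M_t)_{t\ge0}$ is the continuous-time Markov chain on $\mathbb N^2$ with generator $$\mathcal L f(n,m)=\sum_{k=0}^n\sum_{l=0}^m\frac{1}{(n+1)(m+1)}\big(f(n-k+l,\;m-l+k)-f(n,m)\big),$$ and $\widehat{\mathbb E}_{n,m}$ is expectation for this chain started from $(N_0,M_0)=(n,m)$. $D(n,m;x,y)=d(n,x)\,d(m,y)$ with $d(n,x)=\dfrac{x^n}{(n+1)!}$. $\mathcal P_f$ is the set of probability measures on $[0,\infty)^2$ that have finite moments of all orders and are uniquely determined by their moments. For $\theta>0$, $\nu_\theta(dx)=\theta^{-2}\,x\,e^{-x/\theta}\,dx$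 on $[0,\infty)$ is the Gamma distribution with shape parameter $2$ and scale parameter $\theta$. *)

(* Defs.v *)
From HB Require Import structures.
From mathcomp Require Export all_boot all_order all_algebra.
From mathcomp Require Export all_classical all_reals all_analysis.
From mathcomp Require Export measurable_realfun.

Set Implicit Arguments.
Unset Strict Implicit.
Unset Printing Implicit Defensive.

Import Order.TTheory GRing.Theory Num.Theory.
Import numFieldNormedType.Exports.

Local Open Scope classical_set_scope.
Local Open Scope ring_scope.

Section markov_jump_processes.
Context {R : realType} {dE dO : measure_display}.
Context {E : measurableType dE} {Omega : measurableType dO}.

Definition history (Z : R -> Omega -> E) (s : R) : set (set Omega) :=
  <<s \bigcup_(r in `[0, s]) preimage_set_system setT (Z r) measurable >>.

(* Values at negative times are irrelevant. Right-constancy at every time and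
   an eventually constant left limit at every positive time leave finitely
   many jumps in every bounded time interval. *)
Definition step_path (z : R -> E) : Prop :=
  (forall t : R, 0 <= t -> \forall s \near t^'+, z s = z t) /\
  (forall t : R, 0 < t -> exists e, \forall s \near t^'-, z s = e).

(* Time-homogeneous Markov jump process with state space the subset S of E:
   the law P z, relevant only for z in S, starts the process at z. The
   generator L is a bounded operator on the Banach space of bounded measurable
   functions on S with the sup norm, and is the derivative at 0 there of the
   semigroup f |-> (z |-> E_z f(Z_t)). *)
Record markov_jump_process (S : set E) (P : E -> probability Omega R)
    (Z : R -> Omega -> E) (L : (E -> R) -> E -> R) : Prop := {
  mjp_measurable : forall t : R, 0 <= t -> measurable_fun setT (Z t) ;
  mjp_state : forall (t : R) w, 0 <= t -> S (Z t w) ;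
  mjp_path : forall w, step_path (Z ^~ w) ;
  mjp_law_measurable : forall F, measurable F ->
    measurable_fun S (P ^~ F) ;
  mjp_start : forall z, S z -> P z (Z 0 @^-1` [set z]) = 1%E ;
  mjp_markov : forall z (s t : R) F A, S z -> 0 <= s -> 0 <= t ->
    history Z s F -> measurable A ->
    P z (F `&` Z (s + t) @^-1` A) =
      (\int[P z]_(w in F) P (Z s w) (Z t @^-1` A))%E ;
  mjp_generator : forall f : E -> R,
    measurable_fun S f -> [bounded f z | z in S] ->
    forall eps : R, 0 < eps -> \forall t \near 0^'+, forall z, S z ->
      `| (fine 'E_(P z)[fun w => f (Z t w)]%E - f z) / t - L f z | <= eps }.

Definition invariant_measure (S : set E) (P : E -> probability Omega R)
    (Z : R -> Omega -> E) (nu : set E -> \bar R) : Prop :=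
  forall (t : R) A, 0 <= t -> measurable A ->
    (\int[nu]_(z in S) P z (Z t @^-1` A))%E = nu A.

Definition harmonic (S : set E) (P : E -> probability Omega R)
    (Z : R -> Omega -> E) (h : E -> R) : Prop :=
  forall z (t : R), S z -> 0 < t -> ('E_(P z)[fun w => h (Z t w)] = (h z)%:E)%E.

End markov_jump_processes.

Section energy_exchange.
Context {R : realType}.
Local Notation mu := (@lebesgue_measure R).

Definition quadrant : set (R * R) := [set z | 0 <= z.1 /\ 0 <= z.2].

Definition genL (f : R * R -> R) (z : R * R) : R :=
  let: (x, y) := z in
  \int[mu]_(v in `[0, 1]) \int[mu]_(u in `[0, 1])
    (f (x * (1 - u) + y * v, y * (1 - v) + x * u) - f (x, y)).

Definition dual_genL (f : nat * nat -> R) (p : nat * nat) : R :=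
  let: (n, m) := p in
  \sum_(k < n.+1) \sum_(l < m.+1) (n.+1%:R * m.+1%:R)^-1 *
    (f ((n - k + l)%N, (m - l + k)%N) - f (n, m)).

Definition dfun (n : nat) (x : R) : R := x ^+ n / (n.+1)`!%:R.

Definition Dfun (p : nat * nat) (z : R * R) : R := dfun p.1 z.1 * dfun p.2 z.2.

Definition Dtransform (nu : probability (R * R)%type R) (p : nat * nat) : R :=
  \int[nu]_(z in quadrant) Dfun p z.

Definition moment (nu : probability (R * R)%type R) (n m : nat) : \bar R :=
  (\int[nu]_(z in quadrant) (z.1 ^+ n * z.2 ^+ m)%:E)%E.

(* Probability measures on [0, +oo[^2 are encoded as those on R * R giving
   full mass to the quadrant; determinacy is among such measures. *)
Definition Pf : set (probability (R * R)%type R) :=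
  [set nu : probability (R * R)%type R | [/\ nu quadrant = 1%E,
     forall n m, (moment nu n m < +oo)%E &
     forall nu' : probability (R * R)%type R, nu' quadrant = 1%E ->
       (forall n m, moment nu' n m = moment nu n m) ->
       forall A, measurable A -> nu' A = nu A]].

Definition gamma2 (theta : R) : set R -> \bar R := fun A =>
  (\int[mu]_(x in A `&` `[0%R, +oo[)
     (theta ^- 2 * x * expR (- (x / theta)))%:E)%E.

End energy_exchange.

(* Main.v *)
(** The vector (D(p; .)), p ranging over a level n + m = N, satisfies
    L D(p; .) = sum_q (dual generator)(p, q) D(q; .), a Beta-integral identity.
    Both processes preserve a total (x + y, resp. n + m), so that D may be
    replaced by a bounded function and the dual semigroup by a finite matrix;
    then s |-> sum_q Phat_(t-s)(p, q) E_z D(q; Z_s) has increments o(h), uniformly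
    in s, hence is constant, which is the duality E_z D(p; Z_t) = Ehat_p D(N_t; z).
    Integrating against nu, the D-transform of the law at time t of the process
    started from nu is Ehat_p nuhat(N_t), and D-transforms are moments up to
    factorials, so determinacy gives the equivalence.

    For the Gamma product, L = K - 1 where K is the kernel of one exchange. If x is
    Gamma(2) and u is uniform then x(1 - u) and x u are independent exponential
    variables, and conversely; an exchange only regroups four independent
    exponential variables, so nu K = nu, and invariance follows because K commutes
    with the semigroup. *)
From HB Require Import structures.
Require Import Defs.
From mathcomp Require Import unstable ring lra zify.
Import Order.TTheory GRing.Theory Num.Theory.
Import numFieldNormedType.Exports.
Local Open Scope classical_set_scope.
Local Open Scope ring_scope.

Set Implicit Arguments.
Unset Strict Implicit.
Unset Printing Implicit Defensive.

(** * Mixtures of a family of measures *)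

Section mixture.
Local Open Scope ereal_scope.
Context d1 d2 (T1 : measurableType d1) (T2 : measurableType d2) (R : realType).
Variables (mu : {measure set T1 -> \bar R}) (D : set T1).
Variable k : T1 -> {measure set T2 -> \bar R}.

(** The measurability proofs are arguments so that the measure structure can be attached to the term
    itself. *)
Definition mixture (mD : measurable D)
    (mk : forall A, measurable A -> measurable_fun D (fun x => k x A))
    (A : set T2) : \bar R := \int[mu]_(x in D) k x A.

Hypothesis mD : measurable D.
Hypothesis mk : forall A, measurable A -> measurable_fun D (fun x => k x A).

Let mixture0 : mixture mD mk set0 = 0.
Proof. by apply: integral0_eq => x _; rewrite measure0. Qed.

Let mixture_ge0 A : 0 <= mixture mD mk A.
Proof. exact: integral_ge0. Qed.

Let mixture_sigma_additive : semi_sigma_additive (mixture mD mk).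
Proof.
move=> F mF tF mUF; rewrite [X in _ --> X](_ : _ =
    \int[mu]_(x in D) \sum_(0 <= n <oo) k x (F n)); last first.
  apply: eq_integral => x _; apply/esym/cvg_lim => //.
  exact: measure_semi_sigma_additive.
rewrite integral_nneseries//; last by move=> n; exact: mk.
apply: is_cvg_nneseries => n _ _; exact: mixture_ge0.
Qed.

HB.instance Definition _ := isMeasure.Build _ _ _ (mixture mD mk)
  mixture0 mixture_ge0 mixture_sigma_additive.

Lemma measurable_mixture (f : T2 -> \bar R) : (forall y, 0 <= f y) ->
  measurable_fun setT f -> measurable_fun D (fun x => \int[k x]_y f y).
Proof.
move=> f0 mf.
(* The family [k] is measurable only over [D]; the null measure outside [D] extends it to all of
   [T1]. *)
pose l x : {measure set T2 -> \bar R} := if x \in D then k x else mzero.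
have ml U : measurable U -> measurable_fun setT (l ^~ U).
  move=> mU; rewrite (_ : l ^~ U = (fun x => k x U) \_ D).
    by apply/(measurable_restrictT _ _).1 => //; exact: mk.
  by apply/funext => x; rewrite /l patchE; case: ifPn.
have /measurable_funTS h := measurable_fun_integral_kernel ml f0 mf.
apply: eq_measurable_fun (h D) => x xD.
by rewrite /l xD.
Qed.

Import HBNNSimple.

Let integral_mixture_nnsfun (f : {nnsfun T2 >-> R}) :
  \int[mixture mD mk]_y (f y)%:E = \int[mu]_(x in D) \int[k x]_y (f y)%:E.
Proof.
under [RHS]eq_integral do rewrite integralT_nnsfun sintegralE.
rewrite integralT_nnsfun sintegralE ge0_integral_fsum//.
- apply: eq_fsbigr => r _; have [r0|r0] := leP 0%R r.
    by rewrite ge0_integralZl//; exact: mk.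
  (* A nonnegative simple function never takes the negative value [r], so both terms vanish. *)
  rewrite preimage_nnfun0// measure0 mule0 integral0_eq// => x _.
  by rewrite measure0 mule0.
- by move=> r; apply: measurable_funeM; exact: mk.
- move=> r x _; have [r0|r0] := leP 0%R r; first by rewrite mule_ge0.
  by rewrite preimage_nnfun0// measure0 mule0.
Qed.

(** Simple functions first, then monotone convergence twice: under each measure [k x], and under
    [mu] for the resulting increasing sequence of functions of [x]. *)
Lemma integral_mixture (f : T2 -> \bar R) : (forall y, 0 <= f y) ->
  measurable_fun setT f ->
  \int[mixture mD mk]_y f y = \int[mu]_(x in D) \int[k x]_y f y.
Proof.
move=> f0 mf; pose f_ := nnsfun_approx measurableT mf.
have mc (m : {measure set T2 -> \bar R}) :
    \int[m]_y f y = limn (fun n => \int[m]_y (f_ n y)%:E).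
  rewrite -monotone_convergence//; last 3 first.
  - by move=> n; exact/measurable_EFinP.
  - by move=> n y _; rewrite lee_fin.
  - by move=> y _ a b ab; rewrite lee_fin; exact/lefP/nd_nnsfun_approx.
  by apply: eq_integral => y _; apply/esym/cvg_lim => //; exact: cvg_nnsfun_approx.
rewrite mc; under eq_fun do rewrite integral_mixture_nnsfun.
under [RHS]eq_integral do rewrite mc.
rewrite monotone_convergence//.
- move=> n; apply: measurable_mixture => [y|]; first by rewrite lee_fin.
  exact/measurable_EFinP.
- by move=> n x _; apply: integral_ge0 => y _; rewrite lee_fin.
- move=> x _ a b ab; apply: ge0_le_integral => //.
  + by move=> z _; rewrite lee_fin.
  + exact/measurable_EFinP.
  + exact/measurable_EFinP.
  + by move=> z _; rewrite lee_fin; exact/lefP/nd_nnsfun_approx.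
Qed.

End mixture.

(** Cut [0, t] into n equal steps, short enough for the tolerance e / t. The increments then add up
    to at most n (t / n) (e / t) = e. Uniformity in [s] replaces any differentiability of [phi]. *)
Lemma eq_of_small_increments (R : realType) (phi : R -> R) (t : R) : 0 <= t ->
  (forall eps, 0 < eps -> \forall h \near 0^'+, forall s, 0 <= s -> s + h <= t ->
     `|phi (s + h) - phi s| <= h * eps) ->
  phi t = phi 0.
Proof.
rewrite le_eqVlt => /predU1P[<-//|t0] H.
apply/subr0_eq/eqP; rewrite -normr_eq0; apply/eqP/le_anti/andP; split => //.
apply/ler_addgt0Pl => e e0; rewrite addr0.
have et : 0 < e / t by rewrite divr_gt0.
have [dl /= dl0 Hd] := H _ et.
(* The successor makes t / dl < n strict, hence h < dl. *)
pose n := (Num.trunc (t / dl)).+1.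
have n0 : 0 < n%:R :> R by rewrite ltr0n.
pose h := t / n%:R.
have h0 : 0 < h by rewrite divr_gt0.
have hd : h < dl.
  by rewrite ltr_pdivrMr// mulrC -ltr_pdivrMr// truncnS_gt.
have {}Hd s : 0 <= s -> s + h <= t -> `|phi (s + h) - phi s| <= h * (e / t).
  by apply: Hd => //=; rewrite sub0r normrN gtr0_norm.
have step m : (m <= n)%N -> `|phi (m%:R * h) - phi 0| <= m%:R * (h * (e / t)).
  elim: m => [|m IH] mn; first by rewrite !mul0r subrr normr0.
  rewrite -natr1 !mulrDl !mul1r -(subrK (phi (m%:R * h)) (phi _)) -addrA.
  rewrite (le_trans (ler_normD _ _))// [leRHS]addrC lerD ?IH 1?ltnW//.
  apply: Hd; first by rewrite mulr_ge0// ltW.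
  by rewrite -[X in _ + X]mul1r -mulrDl natr1 mulrA ler_pdivrMr// mulrC ler_pM2l// ler_nat.
have := step n (leqnn _).
rewrite {1}/h mulrCA divff ?gt_eqF// mulr1 mulrA [n%:R * h]mulrCA divff ?gt_eqF//.
by rewrite mulr1 mulrCA divff ?gt_eqF// mulr1.
Qed.

(** * Bounded measurable functions on a subset *)

Definition bounded_measurable d (E : measurableType d) (R : realType)
    (S : set E) (f : E -> R) : Prop :=
  measurable_fun S f /\ exists M, forall z, S z -> `|f z| <= M.

Section bounded_measurable.
Context d (E : measurableType d) (R : realType) (S : set E).
Implicit Types f g : E -> R.
Local Notation bm := (bounded_measurable S).

Lemma bounded_measurableD f g : bm f -> bm g -> bm (fun z => f z + g z).
Proof.
move=> [mf [M fM]] [mg [N gN]]; split; first exact: measurable_funD.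
by exists (M + N) => z Sz; rewrite (le_trans (ler_normD _ _))// lerD ?fM ?gN.
Qed.

Lemma bounded_measurableM f g : bm f -> bm g -> bm (fun z => f z * g z).
Proof.
move=> [mf [M fM]] [mg [N gN]]; split; first exact: measurable_funM.
by exists (M * N) => z Sz; rewrite normrM ler_pM ?fM ?gN.
Qed.

Lemma bounded_measurable_cst (c : R) : bm (fun=> c).
Proof. by split; [exact: measurable_cst|exists `|c|]. Qed.

Lemma bounded_measurableZ c f : bm f -> bm (fun z => c * f z).
Proof. exact/bounded_measurableM/bounded_measurable_cst. Qed.

Lemma bounded_measurableB f g : bm f -> bm g -> bm (fun z => f z - g z).
Proof.
move=> bf bg; have := bounded_measurableD bf (bounded_measurableZ (-1) bg).
by under [X in bm X]eq_fun do rewrite mulN1r.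
Qed.

Lemma bounded_measurable_sum (I : Type) (r : seq I) (F : I -> E -> R) :
  (forall i, bm (F i)) -> bm (fun z => \sum_(i <- r) F i z).
Proof.
move=> bF; elim: r => [|i r IH].
  by under [X in bm X]eq_fun do rewrite big_nil; exact: bounded_measurable_cst.
under [X in bm X]eq_fun do rewrite big_cons.
exact: bounded_measurableD.
Qed.

Lemma bounded_measurable_indic A : measurable A -> bm (\1_A : E -> R).
Proof.
move=> mA; split; first exact: measurable_indic.
by exists 1 => z _; rewrite indicE; case: (_ \in _); rewrite ?normr1 ?normr0.
Qed.

Lemma bounded_measurable_bounded f : bm f -> [bounded f z | z in S].
Proof.
move=> [_ [M fM]]; exists M; split; first exact: num_real.
by move=> x Mx z /= Sz; rewrite (le_trans (fM _ Sz))// ltW.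
Qed.

End bounded_measurable.

Lemma probability_setC_eq0 d (T : measurableType d) (R : realType)
    (Q : probability T R) A : measurable A -> Q A = 1%E -> Q (~` A) = 0%E.
Proof. by move=> mA QA; rewrite probability_setC// QA subee. Qed.

(** * Transition semigroup of a Markov jump process *)

Section markov_process.
Context {R : realType} {dE dO : measure_display}.
Context {E : measurableType dE} {Omega : measurableType dO}.
Variables (S : set E) (P : E -> probability Omega R) (Z : R -> Omega -> E).
Variable L : (E -> R) -> E -> R.
Hypothesis mS : measurable S.
Hypothesis proc : markov_jump_process S P Z L.
Implicit Types (f g : E -> R) (t s : R).
Local Notation bm := (bounded_measurable S).

(** The semigroup with real values. A real integral defaults to 0 when the extended one is not
    finite; [EFin_trans] excludes this for bounded [f]. *)
Definition trans t f z : R := \int[P z]_w f (Z t w).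

Let mZ t : 0 <= t -> measurable_fun setT (Z t).
Proof. exact: mjp_measurable proc _. Qed.
Let SZ t w : 0 <= t -> S (Z t w). Proof. exact: mjp_state proc _ _. Qed.

Lemma measurable_process t A : 0 <= t -> measurable A -> measurable (Z t @^-1` A).
Proof. by move=> t0 mA; rewrite -[X in measurable X]setTI; exact: mZ. Qed.

Lemma measurable_fun_process d' (U : measurableType d') t (f : E -> U) : 0 <= t ->
  measurable_fun S f -> measurable_fun setT (fun w => f (Z t w)).
Proof.
move=> t0 mf; apply: (measurable_comp mS) => //.
- by move=> _ [w _ <-]; exact: SZ.
- exact: mZ.
Qed.

Lemma integrable_process t f z : 0 <= t -> bm f ->
  (P z).-integrable setT (fun w => (f (Z t w))%:E).
Proof.
move=> t0 [mf [M fM]].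
apply: (@measurable_bounded_integrable _ _ _ (P z) (fun w => f (Z t w))) => //.
- by rewrite [ltLHS]probability_setT ltry.
- exact: measurable_fun_process.
- exists M; split; first exact: num_real.
  by move=> x Mx w /= _; rewrite (le_trans (fM _ (SZ _ _)))// ltW.
Qed.

Lemma EFin_trans t f z : 0 <= t -> bm f ->
  (trans t f z)%:E = (\int[P z]_w (f (Z t w))%:E)%E.
Proof.
by move=> t0 bf; rewrite fineK//; apply: integrable_fin_num => //;
  exact: integrable_process.
Qed.

Lemma eq_trans t f g z : 0 <= t -> (forall x, S x -> f x = g x) ->
  trans t f z = trans t g z.
Proof. by move=> t0 fg; apply: eq_Rintegral => w _; exact/fg/SZ. Qed.

Lemma transD t f g z : 0 <= t -> bm f -> bm g ->
  trans t (fun x => f x + g x) z = trans t f z + trans t g z.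
Proof. by move=> t0 bf bg; rewrite /trans RintegralD//; exact: integrable_process. Qed.

Lemma transZ t c f z : 0 <= t -> bm f ->
  trans t (fun x => c * f x) z = c * trans t f z.
Proof. by move=> t0 bf; rewrite /trans RintegralZl//; exact: integrable_process. Qed.

Lemma trans_cst t c z : trans t (fun=> c) z = c.
Proof. by rewrite /trans Rintegral_cst// [X in fine X]probability_setT mulr1. Qed.

Lemma transB t f g z : 0 <= t -> bm f -> bm g ->
  trans t (fun x => f x - g x) z = trans t f z - trans t g z.
Proof. by move=> t0 bf bg; rewrite /trans RintegralB//; exact: integrable_process. Qed.

Lemma trans_sum (I : Type) (r : seq I) (F : I -> E -> R) t z : 0 <= t ->
  (forall i, bm (F i)) ->
  trans t (fun x => \sum_(i <- r) F i x) z = \sum_(i <- r) trans t (F i) z.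
Proof.
move=> t0 bF; elim: r => [|i r IH].
  by rewrite big_nil -[RHS](trans_cst t _ z); apply: eq_trans => // x _; rewrite big_nil.
rewrite big_cons -IH -transD//; last exact: bounded_measurable_sum.
by apply: eq_trans => // x _; rewrite big_cons.
Qed.

Lemma trans_ge0 t f z : 0 <= t -> (forall x, S x -> 0 <= f x) -> 0 <= trans t f z.
Proof. by move=> t0 f0; apply: Rintegral_ge0 => w _; exact/f0/SZ. Qed.

Lemma trans_le t f g z : 0 <= t -> bm f -> bm g ->
  (forall x, S x -> f x <= g x) -> trans t f z <= trans t g z.
Proof.
move=> t0 bf bg fg; apply: le_Rintegral => //; [exact: integrable_process..|].
by move=> w _; exact/fg/SZ.
Qed.

(** Contraction in the sup norm, through which one-step errors later pass from time h to all
    times. *)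
Lemma trans_norm_le t f z M : 0 <= t -> bm f -> (forall x, S x -> `|f x| <= M) ->
  `|trans t f z| <= M.
Proof.
move=> t0 bf fM; rewrite ler_norml -{1}(trans_cst t (- M) z) -{2}(trans_cst t M z).
apply/andP; split; (apply: trans_le => //; first exact: bounded_measurable_cst);
  by move=> x Sx; have := fM _ Sx; rewrite ler_norml => /andP[].
Qed.

Definition law t (t0 : 0 <= t) z : probability E R :=
  distribution (P z) (mfun_Sub (mem_set (mZ t0))).

Lemma measurable_law t (t0 : 0 <= t) A : measurable A ->
  measurable_fun S (fun z => law t0 z A).
Proof. by move=> mA; apply: (mjp_law_measurable proc); exact: measurable_process. Qed.

(** The law is a measure on all of [E] while [f] is controlled only on [S]; cutting [f] to 0 off [S]
    is harmless because the process never leaves [S]. *)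
Lemma integral_law t (t0 : 0 <= t) z (f : E -> \bar R) :
  measurable_fun S f -> (forall x, S x -> (0 <= f x)%E) ->
  (\int[law t0 z]_x (f \_ S) x = \int[P z]_w f (Z t w))%E.
Proof.
move=> mf f0; rewrite ge0_integral_pushforward//=.
- by apply: eq_integral => w _ /=; rewrite patchE mem_set//; exact: SZ.
- exact: mZ.
- by move/(measurable_restrictT _ mS) : mf.
- by move=> x _; rewrite erestrict_ge0.
Qed.

Lemma EFin_trans_law t (t0 : 0 <= t) z f : bm f -> (forall x, S x -> 0 <= f x) ->
  (trans t f z)%:E = (\int[law t0 z]_x ((EFin \o f) \_ S) x)%E.
Proof.
move=> bf f0; rewrite EFin_trans// integral_law//=.
by case: bf => mf _; exact/measurable_EFinP.
Qed.

Let law_ge0 f : (forall x, S x -> 0 <= f x) -> forall x, (0 <= ((EFin \o f) \_ S) x)%E.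
Proof. by move=> f0 x; rewrite erestrict_ge0// => {}x /= Sx; rewrite lee_fin f0. Qed.

Let law_meas f : bm f -> measurable_fun setT ((EFin \o f) \_ S).
Proof.
by move=> [mf _]; apply/(measurable_restrictT _ mS); exact/measurable_EFinP.
Qed.

Let shift_ge0 f : bm f -> exists2 M, bm (fun x => f x + M) &
  forall x, S x -> 0 <= f x + M.
Proof.
move=> bf; have [_ [M fM]] := bf; exists M.
  by apply: bounded_measurableD => //; exact: bounded_measurable_cst.
by move=> x /fM; rewrite ler_norml -subr_ge0 opprK => /andP[].
Qed.

Let trans_shift t f M z : 0 <= t -> bm f ->
  trans t f z = trans t (fun x => f x + M) z - M.
Proof.
move=> t0 bf; rewrite transD//; last exact: bounded_measurable_cst.
by rewrite trans_cst addrK.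
Qed.

(** Measurability in the starting point comes from [measurable_mixture], which wants a nonnegative
    integrand: [f] is shifted by its bound, and the shift is subtracted afterwards. *)
Lemma bounded_measurable_trans t f : 0 <= t -> bm f -> bm (trans t f).
Proof.
move=> t0 bf; split; last first.
  by have [_ [M fM]] := bf; exists M => z _; exact: trans_norm_le.
have [M bfM fM0] := shift_ge0 bf.
rewrite (_ : trans t f = fun z => trans t (fun x => f x + M) z - M); last first.
  by apply/funext => z; exact: trans_shift.
apply: measurable_funB => //; apply/measurable_EFinP.
rewrite (_ : EFin \o _ =
    (fun z => \int[law t0 z]_x ((EFin \o (fun x => f x + M)%R) \_ S) x)%E); last first.
  by apply/funext => z /=; exact: EFin_trans_law.
apply: measurable_mixture => //; [exact: measurable_law|exact: law_ge0|exact: law_meas].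
Qed.

(** The Markov property on the whole space says that the law at time s + t is the mixture of the
    laws at time t over the position at time s; [integral_mixture] transfers this from sets to
    functions. *)
Let trans_semigroup_ge0 s t f z : S z -> 0 <= s -> 0 <= t -> bm f ->
  (forall x, S x -> 0 <= f x) -> trans (s + t) f z = trans s (trans t f) z.
Proof.
move=> Sz s0 t0 bf f0; apply: EFin_inj.
have st0 : 0 <= s + t by exact: addr_ge0.
have mk A : measurable A -> measurable_fun setT (fun w => law t0 (Z s w) A).
  by move=> mA; apply: (@measurable_fun_process _ _ s (fun z => law t0 z A)) => //;
    exact: measurable_law.
rewrite (EFin_trans_law st0)//.
rewrite (eq_measure_integral (mixture (P z) measurableT mk)) => [|A mA _].
  rewrite integral_mixture//; [|exact: law_ge0|exact: law_meas].
  rewrite EFin_trans//; last exact: bounded_measurable_trans.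
  by apply: eq_integral => w _; rewrite (EFin_trans_law t0).
rewrite [LHS](_ : _ = P z (setT `&` Z (s + t) @^-1` A)); last by rewrite setTI.
rewrite (mjp_markov proc)//.
(* The whole space belongs to the history as the complement of the empty set. *)
rewrite -setC0 -(setTD set0); apply: sigma_algebraCD; exact: sigma_algebra0.
Qed.

Lemma trans_semigroup s t f z : S z -> 0 <= s -> 0 <= t -> bm f ->
  trans (s + t) f z = trans s (trans t f) z.
Proof.
move=> Sz s0 t0 bf; have [M bfM fM0] := shift_ge0 bf.
rewrite (trans_shift M)// ?addr_ge0// trans_semigroup_ge0//.
rewrite -[X in _ - X = _](trans_cst s M z) -transB//.
- by apply: eq_trans => // x _; rewrite -trans_shift.
- exact: bounded_measurable_trans.
- exact: bounded_measurable_cst.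
Qed.

Lemma trans_generator f eps : bm f -> 0 < eps ->
  \forall h \near 0^'+, 0 < h /\ forall z, S z ->
    `|trans h f z - f z - h * L f z| <= h * eps.
Proof.
move=> bf eps0; have [mf _] := bf.
near=> h; have h0 : 0 < h by near: h; exact: nbhs_right_gt.
split => // z Sz.
have -> : trans h f z - f z - h * L f z = h * ((trans h f z - f z) / h - L f z).
  by rewrite mulrBr mulrCA divff ?gt_eqF// mulr1.
rewrite normrM gtr0_norm// ler_pM2l//.
have : forall z, S z ->
    `| (fine 'E_(P z)[fun w => f (Z h w)]%E - f z) / h - L f z | <= eps.
  near: h; apply: (mjp_generator proc) => //.
  exact: bounded_measurable_bounded.
by move/(_ _ Sz); rewrite unlock.
Unshelve. all: end_near. Qed.

Hypothesis mS1 : forall z : E, measurable [set z].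

(** The process starts at [z] only almost surely, and the exceptional event is measurable because
    points are. *)
Lemma trans0 f z : S z -> bm f -> trans 0 f z = f z.
Proof.
move=> Sz bf; apply: EFin_inj; rewrite EFin_trans//.
rewrite (ae_eq_integral (cst (f z)%:E))//=.
- by rewrite integral_cst// [X in (_ * X)%E]probability_setT mule1.
- by apply/measurable_EFinP; apply: measurable_fun_process => //; case: bf.
- exists (~` (Z 0 @^-1` [set z])); split.
  + exact/measurableC/measurable_process.
  + apply: probability_setC_eq0; first exact: measurable_process.
    exact: mjp_start proc _ Sz.
  + by move=> w /= + Zw; apply; rewrite Zw.
Qed.

Section conservation.
Variable A : set E.
Hypothesis mA : measurable A.
Hypothesis LA : forall z, S z -> L \1_A z = 0.

(** As [L] kills the indicator of [A], the increment of s |-> T_s 1_A is T_s (T_h 1_A - 1_A), which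
    is o(h) uniformly in s. So T_t 1_A keeps its initial value 1. *)
Lemma conserved t z : S z -> A z -> 0 <= t -> P z (Z t @^-1` A) = 1%E.
Proof.
move=> Sz Az t0.
have bA : bm (\1_A : E -> R) by exact: bounded_measurable_indic.
have TA : trans t \1_A z = 1.
  have T0 : trans 0 \1_A z = 1 by rewrite trans0// indicE mem_set.
  rewrite -T0.
  apply: (@eq_of_small_increments _ (fun s => trans s \1_A z)) => // e e0.
  near=> h; have [h0 H] : 0 < h /\ forall z, S z ->
    `|trans h \1_A z - \1_A z - h * L \1_A z| <= h * e.
    by near: h; exact: trans_generator.
  move=> s s0 sht; rewrite trans_semigroup// ?(ltW h0)// -transB//.
    apply: trans_norm_le => //.
      by apply: bounded_measurableB => //; apply: bounded_measurable_trans => //; exact: ltW.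
    by move=> x Sx; have := H _ Sx; rewrite LA// mulr0 subr0.
  by apply: bounded_measurable_trans => //; exact: ltW.
rewrite -[1%E]/(1%:E) -TA EFin_trans//.
by rewrite integral_indic//=; [rewrite setIT|exact: measurable_process].
Unshelve. all: end_near. Qed.

(** Used to replace an unbounded function by its truncation to a conserved set on which it is
    bounded. *)
Lemma integral_conserved t z (f : E -> \bar R) : S z -> A z -> 0 <= t ->
  measurable_fun S f ->
  (\int[P z]_w f (Z t w) = \int[P z]_w (f \_ A) (Z t w))%E.
Proof.
move=> Sz Az t0 mf; apply: ae_eq_integral => //.
- exact: measurable_fun_process.
- apply: measurable_fun_process => //.
  by apply/measurable_restrict => //; apply: measurable_funS mf.
- exists (~` (Z t @^-1` A)); split.
  + exact/measurableC/measurable_process.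
  + by apply: probability_setC_eq0; [exact: measurable_process|exact: conserved].
  + by move=> w /= + Zw; apply => _; rewrite patchE mem_set.
Qed.

End conservation.

End markov_process.

(** * Levels of the total n + m and the dual generator *)

Lemma measurable_pair_set1 d1 d2 (T1 : measurableType d1) (T2 : measurableType d2) :
  (forall x : T1, measurable [set x]) -> (forall y : T2, measurable [set y]) ->
  forall p : T1 * T2, measurable [set p].
Proof.
move=> m1 m2 p; rewrite (_ : [set p] = [set p.1] `*` [set p.2]).
  exact: measurableX.
by case: p => a b; apply/seteqP; split => -[c e] /=; [case=> -> ->|case=> -> ->].
Qed.

Lemma measurable_nat_pair (A : set (nat * nat)) : measurable A.
Proof.
apply: countable_measurable => [p|]; last exact: countableP.
exact: measurable_pair_set1.
Qed.

Definition level (N i : nat) : nat * nat := (i, N - i)%N.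

Definition levelset (N : nat) : set (nat * nat) := [set q | (q.1 + q.2 = N)%N].

Section dual_generator.
Context {R : realType}.
Implicit Types (h : nat * nat -> R) (p : nat * nat).

Lemma levelsetP N i : (i <= N)%N -> levelset N (level N i).
Proof. by move=> iN; rewrite /levelset /= subnKC. Qed.

(** Expansion of [h] in the indicators of the N + 1 points of the level, the basis in which the dual
    process becomes a finite matrix. *)
Lemma sum_level h N p : levelset N p ->
  \sum_(i < N.+1) h (level N i) * \1_[set level N i] p = h p.
Proof.
case: p => a b /= <-; have aN : (a < (a + b).+1)%N by rewrite ltnS leq_addr.
have lev : level (a + b) (Ordinal aN) = (a, b) by rewrite /level /= addKn.
rewrite (bigD1 (Ordinal aN))//= big1 ?addr0.
  by rewrite lev indicE mem_set// mulr1.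
move=> i ia; rewrite indicE memNset ?mulr0// => -[/= aE _].
by move/eqP : ia; apply; apply: val_inj.
Qed.

Let step_level n m (k : 'I_n.+1) (l : 'I_m.+1) :
  levelset (n + m) (n - k + l, m - l + k)%N.
Proof. by have := ltn_ord k; have := ltn_ord l; rewrite /levelset/=; lia. Qed.

(** A jump keeps the total, so both [f] at the target and [f] at the start can be expanded by
    [sum_level] on the same level. *)
Lemma dual_genL_level h N p : levelset N p ->
  dual_genL h p = \sum_(i < N.+1) h (level N i) * dual_genL \1_[set level N i] p.
Proof.
case: p => n m /= <-; rewrite /dual_genL.
under [RHS]eq_bigr do rewrite mulr_sumr.
rewrite [RHS]exchange_big/=; apply: eq_bigr => k _.
under [RHS]eq_bigr do rewrite mulr_sumr.
rewrite [RHS]exchange_big/=; apply: eq_bigr => l _.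
under [RHS]eq_bigr do rewrite mulrCA mulrBr.
by rewrite -mulr_sumr sumrB !sum_level.
Qed.

Lemma dual_genL_levelset N p : dual_genL (\1_(levelset N) : nat * nat -> R) p = 0.
Proof.
case: p => n m; rewrite /dual_genL big1// => k _; rewrite big1// => l _.
rewrite !indicE (_ : (_ \in _) = ((n, m) \in levelset N)) ?subrr ?mulr0//.
have := step_level k l; rewrite /levelset /= => e.
by apply/idP/idP => /set_mem/= H; apply/mem_set => /=; rewrite -H -?e// e.
Qed.

End dual_generator.

(** The restriction to [D] is absorbed into the integrand, to which Tonelli's theorem applies. *)
Lemma measurable_fun_integral_section d1 d2 (T1 : measurableType d1)
    (T2 : measurableType d2) (R : realType)
    (m : {sigma_finite_measure set T2 -> \bar R}) (D : set T2)
    (f : T1 * T2 -> \bar R) : measurable D -> measurable_fun setT f ->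
  (forall p, (0 <= f p)%E) ->
  measurable_fun setT (fun x => \int[m]_(y in D) f (x, y))%E.
Proof.
move=> mD mf f0; under eq_fun do rewrite integral_mkcond.
pose g := f \_ (setT `*` D).
rewrite (_ : (fun x => _) = fubini_F m g); last first.
  apply/funext => x; apply: eq_integral => y _; rewrite /g !patchE.
  by congr (if _ then _ else _); apply/idP/idP => /set_mem/= yD; apply/mem_set => //; case: yD.
apply: measurable_fun_fubini_tonelli_F.
  apply/(measurable_restrictT _ _).1; first exact: measurableX.
  exact: measurable_funTS.
by move=> p; rewrite erestrict_ge0.
Qed.

(** * The kernel of one exchange and the generator of the continuous process *)

Section generator.
Context {R : realType}.
Local Notation mu := (@lebesgue_measure R).
Local Notation quadrant := (@quadrant R).
Local Notation I01 := (`[0%R, 1%R]%classic : set R).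
Local Notation bm := (bounded_measurable quadrant).
Implicit Types (f : R * R -> R) (z : R * R) (u v : R).

(** The argument [v] precedes [u] because it is the outer variable of integration in [genL]. *)
Definition exchange z v u : R * R :=
  (z.1 * (1 - u) + z.2 * v, z.2 * (1 - v) + z.1 * u).

Definition redistribute f z : R :=
  \int[mu]_(v in `[0, 1]) \int[mu]_(u in `[0, 1]) f (exchange z v u).

Lemma measurable_quadrant : measurable quadrant.
Proof.
rewrite (_ : quadrant = `[0, +oo[ `*` `[0, +oo[).
  by apply: measurableX; exact: measurable_itv.
by apply/seteqP; split => -[x y] /=; rewrite !in_itv/= !andbT.
Qed.

Lemma exchange_quadrant z v u : quadrant z -> I01 v -> I01 u ->
  quadrant (exchange z v u).
Proof.
case: z => x y [/= x0 y0]; rewrite !in_itv/= => /andP[v0 v1] /andP[u0 u1].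
by split; rewrite /= addr_ge0// mulr_ge0// subr_ge0.
Qed.

Lemma exchange_sum z v u :
  (exchange z v u).1 + (exchange z v u).2 = z.1 + z.2.
Proof. by rewrite /exchange/=; ring. Qed.

Lemma measurable_exchange :
  measurable_fun setT (fun p : (R * R) * R * R => exchange p.1.1 p.1.2 p.2).
Proof.
have m11 : measurable_fun setT (fun p : (R * R) * R * R => p.1.1).
  exact: measurableT_comp measurable_fst measurable_fst.
have mx : measurable_fun setT (fun p : (R * R) * R * R => p.1.1.1).
  exact: measurableT_comp measurable_fst m11.
have my : measurable_fun setT (fun p : (R * R) * R * R => p.1.1.2).
  exact: measurableT_comp measurable_snd m11.
have mv : measurable_fun setT (fun p : (R * R) * R * R => p.1.2).
  exact: measurableT_comp measurable_snd measurable_fst.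
have mu : measurable_fun setT (fun p : (R * R) * R * R => p.2) by exact: measurable_snd.
apply/measurable_fun_pair; apply: measurable_funD;
  by apply: measurable_funM => //; apply: measurable_funB.
Qed.

(** Extension by 0 gives a globally measurable function, and a nonnegative one if [f] is so on the
    quadrant, as Tonelli requires; an exchange started in the quadrant stays there and sees only
    [f]. *)
Let extend f : R * R -> \bar R := (EFin \o f) \_ quadrant.

Let extend_ge0 f : (forall z, quadrant z -> 0 <= f z) -> forall z, (0 <= extend f z)%E.
Proof. by move=> f0 z; rewrite erestrict_ge0// => x /f0; rewrite lee_fin. Qed.

Let measurable_extend f : bm f -> measurable_fun setT (extend f).
Proof.
move=> [mf _]; apply/(measurable_restrictT _ measurable_quadrant).
exact/measurable_EFinP.
Qed.

Let inner f (p : (R * R) * R) : \bar R :=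
  (\int[mu]_(u in `[0%R, 1%R]) extend f (exchange p.1 p.2 u))%E.

Let inner_ge0 f : (forall z, quadrant z -> 0 <= f z) -> forall p, (0 <= inner f p)%E.
Proof. by move=> f0 p; apply: integral_ge0 => u _; exact: extend_ge0. Qed.

Let measurable_inner f : bm f -> (forall z, quadrant z -> 0 <= f z) ->
  measurable_fun setT (inner f).
Proof.
move=> bf f0; apply: (@measurable_fun_integral_section _ _ _ _ _ mu I01
  (fun p => extend f (exchange p.1.1 p.1.2 p.2))) => //.
  by apply: measurableT_comp; [exact: measurable_extend|exact: measurable_exchange].
by move=> p; exact: extend_ge0.
Qed.

Lemma measurable_fun_exchange f z v : measurable_fun quadrant f -> quadrant z ->
  I01 v -> measurable_fun I01 (fun u => f (exchange z v u)).
Proof.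
move=> mf Sz Iv; apply: (measurable_comp measurable_quadrant) => //.
  by move=> _ [u Iu <-]; exact: exchange_quadrant.
apply: measurable_funTS.
exact: (measurableT_comp measurable_exchange (pair1_measurable (z, v))).
Qed.

Let integrable_I01 (g : R -> R) (M : R) : measurable_fun I01 g ->
  (forall u, I01 u -> `|g u| <= M) -> mu.-integrable I01 (EFin \o g).
Proof.
move=> mg gM; apply: measurable_bounded_integrable => //.
  by rewrite /= lebesgue_measure_itv/= lte01 ltry.
exists M; split; first exact: num_real.
by move=> x Mx u /= Iu; rewrite (le_trans (gM _ Iu))// ltW.
Qed.

Let Rintegral_I01_cst (c : R) : \int[mu]_(u in `[0, 1]) c = c.
Proof. by rewrite Rintegral_cst//= lebesgue_measure_itv/= lte01 sube0 mulr1. Qed.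

Section nonnegative.
Variable f : R * R -> R.
Hypothesis bf : bm f.
Hypothesis f0 : forall z, quadrant z -> 0 <= f z.

Let integrable_section z v : quadrant z -> I01 v ->
  mu.-integrable I01 (fun u => (f (exchange z v u))%:E).
Proof.
move=> Sz Iv; have [mf [M fM]] := bf.
apply: (@integrable_I01 (fun u => f (exchange z v u)) M).
  exact: measurable_fun_exchange.
by move=> u Iu; exact/fM/exchange_quadrant.
Qed.

Let EFin_inner z v : quadrant z -> I01 v ->
  (\int[mu]_(u in `[0, 1]) f (exchange z v u))%:E = inner f (z, v).
Proof.
move=> Sz Iv; rewrite fineK; last first.
  by apply: integrable_fin_num => //; exact: integrable_section.
apply: eq_integral => u /set_mem Iu; rewrite /extend patchE mem_set//.
exact: exchange_quadrant.
Qed.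

Let norm_Rinner z v M : (forall z, quadrant z -> `|f z| <= M) -> quadrant z ->
  I01 v -> `|\int[mu]_(u in `[0, 1]) f (exchange z v u)| <= M.
Proof.
move=> fM Sz Iv; rewrite (le_trans (le_normr_Rintegral _ _))//.
  exact: integrable_section.
rewrite -[leRHS]Rintegral_I01_cst; apply: le_Rintegral => //.
- exact: (integrable_norm (integrable_section Sz Iv)).
- by apply: (@integrable_I01 (fun=> M) `|M|).
- by move=> u Iu; exact/fM/exchange_quadrant.
Qed.

Let integrable_Rinner z : quadrant z -> mu.-integrable I01
  (fun v => (\int[mu]_(u in `[0, 1]) f (exchange z v u))%:E).
Proof.
move=> Sz; have [_ [M fM]] := bf.
apply: (@integrable_I01 (fun v => \int[mu]_(u in `[0, 1]) f (exchange z v u)) M).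
  apply/measurable_EFinP.
  apply: (@eq_measurable_fun _ _ _ _ _ (fun v => inner f (z, v))).
    by move=> v /set_mem Iv; rewrite /= EFin_inner.
  apply: measurable_funTS; apply: measurableT_comp; first exact: measurable_inner.
  exact: pair1_measurable.
by move=> v Iv; exact: norm_Rinner.
Qed.

Lemma EFin_redistribute z : quadrant z -> (redistribute f z)%:E =
  (\int[mu]_(v in `[0%R, 1%R]) \int[mu]_(u in `[0%R, 1%R])
     ((EFin \o f) \_ quadrant) (exchange z v u))%E.
Proof.
move=> Sz; rewrite fineK; last first.
  by apply: integrable_fin_num => //; exact: integrable_Rinner.
by apply: eq_integral => v /set_mem Iv; exact: EFin_inner.
Qed.

(** Partial integrals are measurable by Tonelli, and averaging over intervals of length 1 preserves
    the bound of [f]. *)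
Lemma bounded_measurable_redistribute : bm (redistribute f).
Proof.
split.
  apply/measurable_EFinP.
  apply: (@eq_measurable_fun _ _ _ _ _
    (fun z => \int[mu]_(v in `[0%R, 1%R]) inner f (z, v)))%E.
    by move=> z /set_mem Sz; rewrite [RHS]EFin_redistribute.
  apply: measurable_funTS; apply: measurable_fun_integral_section => //.
    exact: measurable_inner.
  exact: inner_ge0.
have [_ [M fM]] := bf; exists M => z Sz.
rewrite (le_trans (le_normr_Rintegral _ _))//; first exact: integrable_Rinner.
rewrite -[leRHS]Rintegral_I01_cst; apply: le_Rintegral => //.
- exact: (integrable_norm (integrable_Rinner Sz)).
- by apply: (@integrable_I01 (fun=> M) `|M|).
- by move=> v Iv; exact: norm_Rinner.
Qed.

(** Both integrals of a bounded [f] are finite and [0, 1] has mass 1, so the constant [f z] comes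
    out of each. *)
Lemma genLE z : quadrant z -> genL f z = redistribute f z - f z.
Proof.
case: z => x y Sz; rewrite -[X in _ = _ - X]Rintegral_I01_cst -RintegralB//.
- apply: eq_Rintegral => v /set_mem Iv.
  rewrite -[X in _ = _ - X]Rintegral_I01_cst -RintegralB//.
    exact: integrable_section.
  exact: (@integrable_I01 (fun=> f (x, y)) `|f (x, y)|).
- exact: integrable_Rinner.
- exact: (@integrable_I01 (fun=> f (x, y)) `|f (x, y)|).
Qed.

End nonnegative.

End generator.

Lemma Rintegral_sum d (T : measurableType d) (R : realType)
    (m : {measure set T -> \bar R}) (D : set T) (I : Type) (r : seq I)
    (F : I -> T -> R) : measurable D ->
  (forall i, m.-integrable D (EFin \o F i)) ->
  \int[m]_(x in D) (\sum_(i <- r) F i x) = \sum_(i <- r) \int[m]_(x in D) F i x.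
Proof.
move=> mD iF; elim: r => [|i r IH].
  rewrite big_nil; under eq_Rintegral do rewrite big_nil.
  by rewrite Rintegral_cst// mul0r.
rewrite big_cons -IH; under eq_Rintegral do rewrite big_cons.
apply: RintegralD => //; have := @integrable_sum _ _ _ m D mD _ r predT
  (fun j x => (F j x)%:E) (fun j _ => iF j).
by apply: eq_integrable => // x _ /=; rewrite sumEFin.
Qed.

(** * Intertwining of the two generators by D *)

Section intertwining.
Context {R : realType}.
Local Notation mu := (@lebesgue_measure R).
Local Notation quadrant := (@quadrant R).
Local Notation bm := (bounded_measurable quadrant).
Implicit Types (p : nat * nat) (z : R * R).

Let integralX a b : \int[mu]_(x in `[0, 1]) XMonemX a b x =
  (a`! * b`!)%:R / (a + b).+1`!%:R.
Proof. by rewrite -beta_fun_fact /beta_fun -Rintegral_mkcond. Qed.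

Let integrable_ZX (c : R) a b :
  mu.-integrable `[0, 1] (EFin \o (fun u => c * XMonemX a b u)).
Proof. 
have /(_ c) := @integrableZl _ (measurableTypeR R) R mu _ (measurable_itv _) _ _ (integrable_XMonemX a b).
exact. Qed.

(** Expand both powers binomially. The (k, l) term separates into v^k (1 - v)^(m - l) and u^l (1 -
    u)^(n - k). Their Beta integrals have as denominators the factorials of D at (n - k + l, m - l +
    k), and their numerators cancel the binomials, leaving 1 / ((n + 1) (m + 1)). *)
Lemma redistribute_Dfun p z : redistribute (Dfun p) z =
  \sum_(k < p.1.+1) \sum_(l < p.2.+1) (p.1.+1%:R * p.2.+1%:R)^-1 *
    Dfun (p.1 - k + l, p.2 - l + k)%N z.
Proof.
case: p z => n m [x y] /=.
pose c (k l : nat) : R := ('C(n, k) * 'C(m, l))%:R *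
  (x ^+ (n - k + l) * y ^+ (m - l + k)) / (n.+1`!%:R * m.+1`!%:R).
have E v u : Dfun (n, m) (exchange (x, y) v u) =
    \sum_(q : 'I_n.+1 * 'I_m.+1)
      (c q.1 q.2 * XMonemX q.1 (m - q.2) v) * XMonemX q.2 (n - q.1) u.
  rewrite -(pair_bigA _ (fun (k : 'I_n.+1) (l : 'I_m.+1) =>
    (c k l * XMonemX k (m - l) v) * XMonemX l (n - k) u))/=.
  rewrite /Dfun /dfun /= mulrACA -invfM !exprDn big_distrlr/= mulr_suml.
  apply: eq_bigr => k _; rewrite mulr_suml; apply: eq_bigr => l _.
  rewrite /c /XMonemX /unstable.onem -[_ *+ 'C(n, k)]mulr_natl -[_ *+ 'C(m, l)]mulr_natl natrM !exprMn !exprD.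
  move: ('C(n, k)%:R : R) ('C(m, l)%:R : R) ((n.+1)`!%:R * (m.+1)`!%:R)^-1.
  move: (x ^+ _) (x ^+ _) (y ^+ _) (y ^+ _) (v ^+ _) (u ^+ _) ((1 - u) ^+ _) ((1 - v) ^+ _).
  move=> *; ring.
rewrite /redistribute.
under eq_Rintegral => v _.
  under eq_Rintegral do rewrite E.
  rewrite Rintegral_sum//.
  under eq_bigr do rewrite RintegralZl ?integrable_XMonemX// integralX mulrAC.
  over.
rewrite Rintegral_sum//.
rewrite pair_bigA/=; apply: eq_bigr => -[k l] _ /=.
rewrite RintegralZl ?integrable_XMonemX// integralX.
have kn : (k <= n)%N by rewrite -ltnS.
have lm : (l <= m)%N by rewrite -ltnS.
(* With n! and m! written through binomial coefficients, the identity becomes rational in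
   independent nonzero quantities. *)
rewrite /Dfun /dfun /c/= natrM [(l + _)%N]addnC [(k + _)%N]addnC !factS.
rewrite -(bin_fact kn) -(bin_fact lm) !natrM.
have N0 a : a`!%:R != 0 :> R by rewrite pnatr_eq0 -lt0n fact_gt0.
have S0 a : a.+1%:R != 0 :> R by rewrite pnatr_eq0.
have C0 : 'C(n, k)%:R != 0 :> R by rewrite pnatr_eq0 -lt0n bin_gt0.
have D0 : 'C(m, l)%:R != 0 :> R by rewrite pnatr_eq0 -lt0n bin_gt0.
move: (x ^+ _) (y ^+ _) (N0 k) (N0 l) (N0 (n - k)%N) (N0 (m - l)%N)
  (N0 (n - k + l)%N) (N0 (m - l + k)%N) (S0 n) (S0 m) (S0 (n - k + l)%N)
  (S0 (m - l + k)%N) C0 D0.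
move: (k`!%:R : R) (l`!%:R : R) ((n - k)`!%:R : R) ((m - l)`!%:R : R)
  ((n - k + l)`!%:R : R) ((m - l + k)`!%:R : R) (n.+1%:R : R) (m.+1%:R : R)
  ((n - k + l).+1%:R : R) ((m - l + k).+1%:R : R) ('C(n, k)%:R : R)
  ('C(m, l)%:R : R).
by move=> *; field; repeat (apply/andP; split).
Qed.

(** A bounded set that exchanges preserve, since x + y is constant; truncating D to it costs nothing
    and gives a bounded function. *)
Definition simplex (C : R) : set (R * R) := quadrant `&` [set z | z.1 + z.2 <= C].

Definition truncated_Dfun (C : R) p z : R := Dfun p z * \1_(simplex C) z.

Lemma measurable_simplex C : measurable (simplex C).
Proof.
apply: measurableI; first exact: measurable_quadrant.
rewrite -[X in measurable X]setTI.
apply: (@measurable_fun_le _ _ _ setT (fun z : R * R => z.1 + z.2) (cst C)) => //.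
by apply: measurable_funD; [exact: measurable_fst|exact: measurable_snd].
Qed.

Lemma simplex_exchange C z v u : quadrant z ->
  `[0%R, 1%R]%classic v -> `[0%R, 1%R]%classic u ->
  \1_(simplex C) (exchange z v u) = \1_(simplex C) z :> R.
Proof.
move=> Sz Iv Iu; rewrite !indicE; congr (_%:R); congr nat_of_bool.
have Se := exchange_quadrant Sz Iv Iu.
have es := exchange_sum z v u.
by apply/idP/idP => /set_mem[_/=]; [rewrite es|rewrite -es] => h; exact/mem_set.
Qed.

Lemma measurable_Dfun p : measurable_fun setT (Dfun p : R * R -> R).
Proof.
rewrite /Dfun /dfun.
by apply: measurable_funM; apply: measurable_funM => //; apply: measurable_funX;
  [exact: measurable_fst|exact: measurable_snd].
Qed.

Lemma dfun_ge0 n (x : R) : 0 <= x -> 0 <= dfun n x.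
Proof. by move=> x0; rewrite divr_ge0// exprn_ge0. Qed.

Lemma Dfun_ge0 p z : quadrant z -> 0 <= Dfun p z.
Proof. by move=> [x0 y0]; rewrite mulr_ge0// dfun_ge0. Qed.

Lemma truncated_Dfun_ge0 C p z : quadrant z -> 0 <= truncated_Dfun C p z.
Proof. by move=> Sz; rewrite mulr_ge0// Dfun_ge0. Qed.

Lemma bounded_measurable_truncated_Dfun C p : bm (truncated_Dfun C p).
Proof.
split.
  rewrite /truncated_Dfun; apply: measurable_funM.
    by apply: measurable_funTS; exact: measurable_Dfun.
  by apply: measurable_indic; exact: measurable_simplex.
(* The absolute value keeps the bound nonnegative when [C] is negative and the simplex is empty. *)
exists (dfun p.1 `|C| * dfun p.2 `|C|) => z Sz.
rewrite /truncated_Dfun indicE; case: (boolP (_ \in _)) => [|_]; last first.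
  by rewrite mulr0 normr0 mulr_ge0// dfun_ge0.
move=> /set_mem[[x0 y0] /= zC]; rewrite mulr1 ger0_norm ?Dfun_ge0//.
have dC n x : 0 <= x -> x <= `|C| -> dfun n x <= dfun n `|C|.
  move=> ? ?; rewrite ler_wpM2r ?invr_ge0// lerXn2r// nnegrE//.
by have CC := ler_norm C; apply: ler_pM; rewrite ?dfun_ge0 ?dC//; lra.
Qed.

Lemma redistribute_truncated_Dfun C p z : quadrant z ->
  redistribute (truncated_Dfun C p) z = redistribute (Dfun p) z * \1_(simplex C) z.
Proof.
move=> Sz; have E v u : `[0%R, 1%R]%classic v -> `[0%R, 1%R]%classic u ->
    truncated_Dfun C p (exchange z v u) = Dfun p (exchange z v u) * \1_(simplex C) z.
  by move=> Iv Iu; rewrite /truncated_Dfun simplex_exchange.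
have [zC|zC] := boolP (z \in simplex C).
  rewrite indicE zC mulr1; apply: eq_Rintegral => v /set_mem Iv.
  by apply: eq_Rintegral => u /set_mem Iu; rewrite E// indicE zC mulr1.
rewrite indicE (negbTE zC) mulr0.
have z0 : \int[mu]_(v in `[0, 1]) (0 : R) = 0 by rewrite Rintegral_cst// mul0r.
rewrite -[RHS]z0; apply: eq_Rintegral => v /set_mem Iv.
rewrite -[RHS]z0; apply: eq_Rintegral => u /set_mem Iu.
by rewrite E// indicE (negbTE zC) mulr0.
Qed.

(** Duality at the level of generators: the indicator factors out on both sides, and what remains is
    [redistribute_Dfun]. *)
Lemma genL_truncated_Dfun C p z : quadrant z ->
  genL (truncated_Dfun C p) z = dual_genL (fun q => truncated_Dfun C q z) p.
Proof.
move=> Sz; rewrite genLE//.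
- rewrite redistribute_truncated_Dfun// redistribute_Dfun.
  case: p => n m; rewrite /truncated_Dfun /dual_genL -mulrBl.
  under [RHS]eq_bigr do under eq_bigr do rewrite -mulrBl mulrA.
  under [RHS]eq_bigr do rewrite -mulr_suml.
  rewrite -mulr_suml; congr (_ * _).
  under [RHS]eq_bigr do under eq_bigr do rewrite mulrBr.
  under [RHS]eq_bigr do rewrite sumrB.
  rewrite sumrB; congr (_ - _).
  (* The (n + 1) (m + 1) weights of the dual generator sum to 1. *)
  rewrite !sumr_const !card_ord -mulrnA -[RHS]mulr_natl natrM.
  rewrite [n.+1%:R * _]mulrC mulrA divff ?mul1r// mulf_neq0 ?pnatr_eq0//.
- exact: bounded_measurable_truncated_Dfun.
- by move=> x Sx; exact: truncated_Dfun_ge0.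
Qed.

Lemma genL_simplex C z : quadrant z -> genL (\1_(simplex C) : R * R -> R) z = 0.
Proof.
move=> Sz; rewrite genLE//.
- rewrite /redistribute.
  under eq_Rintegral => v /set_mem Iv.
    under eq_Rintegral => u /set_mem Iu do rewrite simplex_exchange//.
    rewrite Rintegral_cst//= lebesgue_measure_itv/= lte01 sube0 mulr1.
    over.
  by rewrite Rintegral_cst//= lebesgue_measure_itv/= lte01 sube0 mulr1 subrr.
- by apply: bounded_measurable_indic; exact: measurable_simplex.
Qed.

End intertwining.

(** * The dual semigroup as a finite matrix on each level *)

Section dual_process.
Context {R : realType} {d' : measure_display} {Omega' : measurableType d'}.
Variables (Phat : nat * nat -> probability Omega' R) (NM : R -> Omega' -> nat * nat).
Hypothesis NM_process : markov_jump_process setT Phat NM dual_genL.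
Implicit Types (h : nat * nat -> R) (p : nat * nat) (t : R) (N : nat).
Local Notation bm := (bounded_measurable [set: nat * nat]).
Local Notation dtrans := (trans Phat NM).

Let measurable_dual d2 (U : measurableType d2) (h : nat * nat -> U) : measurable_fun setT h.
Proof. by move=> _ Y _; exact: measurable_nat_pair. Qed.

Let bm_indic N i : bm (\1_[set level N i] : nat * nat -> R).
Proof. by apply: bounded_measurable_indic; exact: measurable_nat_pair. Qed.

(** The chain almost surely stays on its level, so even an unbounded [h] has a finite expectation, a
    sum weighted by transition probabilities. The semigroup properties below extend to such [h]
    through this formula. *)
Lemma integral_dual t N p h : 0 <= t -> levelset N p ->
  (\int[Phat p]_w (h (NM t w))%:E =
   (\sum_(i < N.+1) h (level N i) * dtrans t \1_[set level N i] p)%:E)%E.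
Proof.
move=> t0 Np; rewrite (@integral_conserved _ _ _ _ _ _ _ _ _ measurableT NM_process
  (fun q => measurable_nat_pair _) _ (measurable_nat_pair (levelset N))
  (fun q _ => dual_genL_levelset N q) t p (EFin \o h))//; last exact: measurable_dual.
transitivity (\int[Phat p]_w
    (\sum_(i < N.+1) h (level N i) * \1_[set level N i] (NM t w))%:E)%E.
  apply: eq_integral => w _; rewrite patchE; case: ifPn => [/set_mem|] wN.
    by rewrite /= sum_level.
  rewrite big1// => i _; rewrite indicE memNset ?mulr0// => /= wi.
  move/negP : wN; apply; apply/mem_set; rewrite wi; apply: levelsetP.
  by rewrite -ltnS.
rewrite -(EFin_trans (f := fun q => \sum_(i < N.+1) h (level N i) *
  \1_[set level N i] q) measurableT NM_process)//.
- rewrite (trans_sum measurableT NM_process)//.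
    by congr (_%:E); apply: eq_bigr => i _; rewrite (transZ measurableT NM_process).
  by move=> i; exact: bounded_measurableZ.
- by apply: bounded_measurable_sum => i; exact: bounded_measurableZ.
Qed.

Lemma dual_trans_level t N p h : 0 <= t -> levelset N p ->
  dtrans t h p = \sum_(i < N.+1) h (level N i) * dtrans t \1_[set level N i] p.
Proof. by move=> t0 Np; rewrite {1}/trans /Rintegral (integral_dual _ t0 Np). Qed.

Lemma eq_dual_trans t N p g h : 0 <= t -> levelset N p ->
  (forall q, levelset N q -> g q = h q) -> dtrans t g p = dtrans t h p.
Proof.
move=> t0 Np gh; rewrite !(dual_trans_level _ t0 Np).
by apply: eq_bigr => i _; rewrite gh//; apply: levelsetP; rewrite -ltnS.
Qed.

Lemma dual_transB t p g h : 0 <= t ->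
  dtrans t (fun q => g q - h q) p = dtrans t g p - dtrans t h p.
Proof.
move=> t0; have Np : levelset (p.1 + p.2) p by [].
rewrite !(dual_trans_level _ t0 Np) -sumrB; apply: eq_bigr => i _.
by rewrite mulrBl.
Qed.

Lemma dual_trans_norm_le t N p h e : 0 <= t -> levelset N p ->
  (forall q, levelset N q -> `|h q| <= e) -> `|dtrans t h p| <= e.
Proof.
move=> t0 Np he.
have e0 : 0 <= e by rewrite (le_trans _ (he p Np)).
(* The bound on [h] holds only on the level; truncation makes it global. *)
rewrite (eq_dual_trans t0 Np (h := fun q => h q * \1_(levelset N) q)); last first.
  by move=> q Nq; rewrite indicE mem_set// mulr1.
have hb q : `|h q * \1_(levelset N) q| <= e.
  rewrite indicE; case: (boolP (_ \in _)) => [/set_mem/he|]; rewrite ?mulr1//.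
  by rewrite mulr0 normr0.
apply: (trans_norm_le measurableT NM_process) => //.
by split; [exact: measurable_dual|exists e].
Qed.

Lemma dual_trans0 h p : dtrans 0 h p = h p.
Proof.
have Np : levelset (p.1 + p.2) p by [].
rewrite (dual_trans_level _ (lexx 0) Np) -[RHS](sum_level h Np).
apply: eq_bigr => i _; rewrite (trans0 measurableT NM_process)// => q.
exact: measurable_nat_pair.
Qed.

Lemma dual_trans_semigroup s t h p : 0 <= s -> 0 <= t ->
  dtrans (s + t) h p = dtrans s (dtrans t h) p.
Proof.
move=> s0 t0; have Np : levelset (p.1 + p.2) p by [].
rewrite (dual_trans_level _ (addr_ge0 s0 t0) Np).
rewrite (eq_dual_trans s0 Np (fun q Nq => dual_trans_level h t0 Nq)).
rewrite (trans_sum measurableT NM_process)//; last first.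
  move=> i; apply: bounded_measurableZ.
  by apply: (bounded_measurable_trans measurableT NM_process).
apply: eq_bigr => i _; rewrite (trans_semigroup measurableT NM_process)//.
rewrite (transZ measurableT NM_process)//.
by apply: (bounded_measurable_trans measurableT NM_process).
Qed.

End dual_process.

Lemma levelset_level N q : levelset N q -> exists i : 'I_N.+1, q = level N i.
Proof.
case: q => a b /= <-; have aN : (a < (a + b).+1)%N by rewrite ltnS leq_addr.
by exists (Ordinal aN); rewrite /level /= addKn.
Qed.

(** * Duality of the two semigroups *)

Section duality.
Context {R : realType} {d d' : measure_display}.
Context {Omega : measurableType d} {Omega' : measurableType d'}.
Variables (P : R * R -> probability Omega R) (XY : R -> Omega -> R * R).
Variables (Phat : nat * nat -> probability Omega' R) (NM : R -> Omega' -> nat * nat).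
Hypothesis XY_process : markov_jump_process quadrant P XY genL.
Hypothesis NM_process : markov_jump_process setT Phat NM dual_genL.
Implicit Types (p : nat * nat) (z : R * R) (t : R) (N : nat).
Local Notation quadrant := (@quadrant R).
Local Notation T := (trans P XY).
Local Notation dtrans := (trans Phat NM).

Let mS := @measurable_quadrant R.
Let bmD C p : bounded_measurable quadrant (truncated_Dfun C p).
Proof. exact: bounded_measurable_truncated_Dfun. Qed.
Let bm_indic N i : bounded_measurable setT (\1_[set level N i] : nat * nat -> R).
Proof. by apply: bounded_measurable_indic; exact: measurable_nat_pair. Qed.
Hint Resolve bmD bm_indic : core.

Let measurable_point (x : R * R) : measurable [set x].
Proof. exact: measurable_pair_set1. Qed.

(** Both semigroups are 1 + h (generator) + o(h), and the generators agree on truncated D.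
    Uniformity in [q] holds because a level is finite, uniformity in [z] because truncated D is
    bounded. *)
Lemma one_step_duality C N eps : 0 < eps ->
  \forall h \near 0^'+, 0 < h /\ forall q, levelset N q -> forall z, quadrant z ->
    `|T h (truncated_Dfun C q) z - dtrans h (fun r => truncated_Dfun C r z) q| <= h * eps.
Proof.
move=> eps0.
have [_ [B fB]] : bounded_measurable quadrant
    (fun z => \sum_(i < N.+1) truncated_Dfun C (level N i) z).
  exact: bounded_measurable_sum.
have B0 : 0 <= B by apply: le_trans (fB (0, 0) _) => //; split.
(* Half of [eps] goes to each process. On the dual side the errors of the indicators are weighted by
   values of D with sum at most [B]; adding 1 avoids dividing by 0. *)
pose dl := eps / 2 / (B + 1).
have dl0 : 0 < dl by rewrite /dl !divr_gt0// ltr_pwDr.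
have e20 : 0 < eps / 2 by rewrite divr_gt0.
near=> h.
have h0 : 0 < h by near: h; exact: nbhs_right_gt.
have TL : forall i : 'I_N.+1, 0 < h /\ forall z, quadrant z ->
    `|T h (truncated_Dfun C (level N i)) z - truncated_Dfun C (level N i) z
      - h * genL (truncated_Dfun C (level N i)) z| <= h * (eps / 2).
  near: h; apply: filter_forall => i.
  exact: (trans_generator XY_process).
have DL : forall i : 'I_N.+1, 0 < h /\ forall q, setT q ->
    `|dtrans h \1_[set level N i] q - \1_[set level N i] q
      - h * dual_genL \1_[set level N i] q| <= h * dl.
  near: h; apply: filter_forall => i.
  exact: (trans_generator NM_process).
split => // q Nq z Sz.
have DLq : `|dtrans h (fun r => truncated_Dfun C r z) q - truncated_Dfun C q z
     - h * dual_genL (fun r => truncated_Dfun C r z) q| <= h * (eps / 2).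
  rewrite (dual_trans_level NM_process _ (ltW h0) Nq) (dual_genL_level _ Nq).
  rewrite -[X in _ - X - _](sum_level (fun r => truncated_Dfun C r z) Nq).
  rewrite mulr_sumr -!sumrB.
  rewrite (le_trans (ler_norm_sum _ _ _))//.
  apply: (@le_trans _ _ (\sum_(i < N.+1) truncated_Dfun C (level N i) z * (h * dl))).
    apply: ler_sum => i _; rewrite mulrCA -!mulrBr normrM ger0_norm ?truncated_Dfun_ge0//.
    by rewrite ler_wpM2l ?truncated_Dfun_ge0//; exact: (DL i).2.
  rewrite -mulr_suml mulrCA ler_pM2l//.
  apply: (@le_trans _ _ ((B + 1) * dl)).
    rewrite ler_pM2r//; have := fB _ Sz; rewrite ler_norml => /andP[_]; lra.
  by rewrite /dl mulrCA divff ?mulr1// gt_eqF// ltr_pwDr.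
have [i qE] := levelset_level Nq.
have := (TL i).2 _ Sz; rewrite -qE genL_truncated_Dfun//.
move: DLq; rewrite [h * eps](_ : _ = h * (eps / 2) + h * (eps / 2)); last by field.
move: (h * (eps / 2)) (T h _ z) (dtrans h _ q) (h * _) (truncated_Dfun _ _ _) => a b c e f.
by rewrite !ler_norml => /andP[? ?] /andP[? ?]; apply/andP; split; lra.
Unshelve. all: end_near. Qed.

Lemma truncated_duality C t p z : 0 <= t -> quadrant z ->
  T t (truncated_Dfun C p) z = dtrans t (fun q => truncated_Dfun C q z) p.
Proof.
move=> t0 Sz; have Np : levelset (p.1 + p.2) p by [].
set N := (p.1 + p.2)%N in Np.
(* This interpolates between the two sides. Its increment over [s, s + h] is the dual semigroup at
   time t - s - h applied to T_s of the one-step error, and both are contractions. *)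
pose phi s := dtrans (t - s) (fun q => T s (truncated_Dfun C q) z) p.
have <- : phi t = T t (truncated_Dfun C p) z by rewrite /phi subrr (dual_trans0 NM_process).
have <- : phi 0 = dtrans t (fun q => truncated_Dfun C q z) p.
  rewrite /phi subr0; apply: (eq_dual_trans NM_process t0 Np) => q _.
  apply: (trans0 mS XY_process) => //; exact: measurable_point.
apply: eq_of_small_increments => // e e0.
near=> h; have [h0 H] : 0 < h /\ forall q, levelset N q -> forall z, quadrant z ->
    `|T h (truncated_Dfun C q) z - dtrans h (fun r => truncated_Dfun C r z) q| <= h * e.
  by near: h; exact: one_step_duality.
move=> s s0 sht.
have th0 : 0 <= t - (s + h) by rewrite subr_ge0.
rewrite /phi (_ : t - s = t - (s + h) + h); last by ring.
rewrite [X in _ - X](dual_trans_semigroup NM_process) ?(ltW h0)//.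
rewrite -(dual_transB NM_process)//.
apply: (dual_trans_norm_le NM_process th0 Np) => q Nq.
rewrite (dual_trans_level NM_process _ (ltW h0) Nq).
rewrite (trans_semigroup mS XY_process) ?(ltW h0)//.
pose g z' := dtrans h (fun r => truncated_Dfun C r z') q.
have gE z' : g z' = \sum_(i < N.+1) dtrans h \1_[set level N i] q * truncated_Dfun C (level N i) z'.
  by rewrite /g (dual_trans_level NM_process _ (ltW h0) Nq); apply: eq_bigr => i _; rewrite mulrC.
have bg : bounded_measurable quadrant g.
  have -> : g = fun z' => \sum_(i < N.+1)
      dtrans h \1_[set level N i] q * truncated_Dfun C (level N i) z'.
    by apply/funext => z'; exact: gE.
  apply: (@bounded_measurable_sum _ _ _ quadrant _ _ (fun (i : 'I_N.+1) z' =>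
    dtrans h \1_[set level N i] q * truncated_Dfun C (level N i) z')) => i.
  exact: bounded_measurableZ.
(* The dual matrix is a finite linear combination, so it commutes with T_s. *)
have -> : \sum_(i < N.+1) T s (truncated_Dfun C (level N i)) z * dtrans h \1_[set level N i] q = T s g z.
  rewrite (eq_trans XY_process _ s0 (fun x _ => gE x)) (trans_sum mS XY_process)//.
    by apply: eq_bigr => i _; rewrite (transZ mS XY_process)// mulrC.
  by move=> i; exact: bounded_measurableZ.
have bT : bounded_measurable quadrant (T h (truncated_Dfun C q)).
  by apply: (bounded_measurable_trans mS XY_process) => //; exact: ltW.
rewrite -(transB mS XY_process)//.
apply: (trans_norm_le mS XY_process) => //.
- exact: bounded_measurableB.
- by move=> x Sx; exact: H.
Unshelve. all: end_near. Qed.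

Lemma duality t p z : 0 <= t -> quadrant z ->
  (\int[P z]_w (Dfun p (XY t w))%:E = (dtrans t (fun q => Dfun q z) p)%:E)%E.
Proof.
move=> t0 Sz; pose C := z.1 + z.2.
have zC : simplex C z by split => /=.
rewrite (@integral_conserved _ _ _ _ _ _ _ _ _ mS XY_process measurable_point _
  (measurable_simplex C) (@genL_simplex R C) t z (EFin \o Dfun p))//; last first.
  by apply/measurable_EFinP/measurable_funTS; exact: measurable_Dfun.
rewrite [LHS](_ : _ = (\int[P z]_w (truncated_Dfun C p (XY t w))%:E)%E); last first.
  apply: eq_integral => w _; rewrite patchE /truncated_Dfun indicE.
  by case: ifPn => _ /=; rewrite ?mulr1// mulr0.
rewrite -(EFin_trans mS XY_process)// truncated_duality//.
congr (_%:E); apply: (eq_dual_trans NM_process t0 (N := (p.1 + p.2)%N)) => // q _.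
by rewrite /truncated_Dfun indicE mem_set// mulr1.
Qed.

End duality.

(** * Moments and D-transforms *)

Lemma momentE (R : realType) (nu : probability (R * R)%type R) n m :
  moment nu n m =
  ((n.+1`! * m.+1`!)%:R%:E * \int[nu]_(z in quadrant) (Dfun (n, m) z)%:E)%E.
Proof.
rewrite -ge0_integralZl_EFin//; last 3 first.
- exact: measurable_quadrant.
- by move=> z Sz; rewrite lee_fin Dfun_ge0.
- by apply/measurable_EFinP/measurable_funTS; exact: measurable_Dfun.
apply: eq_integral => z _; congr (_%:E).
rewrite natrM /Dfun /dfun/= mulrACA; congr (_ * _);
  by rewrite mulrCA divff ?mulr1// pnatr_eq0 -lt0n fact_gt0.
Qed.

(** Finite moments ensure that the real-valued transform is not the default value of a divergent
    integral. *)
Lemma EFin_Dtransform (R : realType) (nu : probability (R * R)%type R) p :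
  Pf nu -> (\int[nu]_(z in quadrant) (Dfun p z)%:E = (Dtransform nu p)%:E)%E.
Proof.
case: p => n m [_ /(_ n m) + _]; rewrite momentE => fin.
have ge0 : (0 <= \int[nu]_(z in quadrant) (Dfun (n, m) z)%:E)%E.
  by apply: integral_ge0 => z Sz; rewrite lee_fin Dfun_ge0.
rewrite fineK// ge0_fin_numE// ltey; apply/eqP => E; move: fin.
by rewrite E mulry gtr0_sg ?mul1e// ltr0n muln_gt0 !fact_gt0.
Qed.

(** * Invariance and harmonicity *)

Section invariance.
Context {R : realType} {d d' : measure_display}.
Context {Omega : measurableType d} {Omega' : measurableType d'}.
Variables (P : R * R -> probability Omega R) (XY : R -> Omega -> R * R).
Variables (Phat : nat * nat -> probability Omega' R) (NM : R -> Omega' -> nat * nat).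
Hypothesis XY_process : markov_jump_process quadrant P XY genL.
Hypothesis NM_process : markov_jump_process setT Phat NM dual_genL.
Local Notation quadrant := (@quadrant R).
Local Notation dtrans := (trans Phat NM).
Variable nu : probability (R * R)%type R.
Hypothesis nuP : Pf nu.

Let mS := @measurable_quadrant R.

(* The law at time t of the process with initial law nu. *)
Definition evolved (t : R) (t0 : 0 <= t) : set (R * R) -> \bar R :=
  mixture nu mS (measurable_law XY_process t0).

Let evolvedT (t : R) (t0 : 0 <= t) : evolved t0 setT = 1%E.
Proof.
rewrite /evolved /mixture; have [nu1 _ _] := nuP; rewrite -nu1.
rewrite (eq_integral (cst 1%E)); last by move=> z _; exact: probability_setT.
by rewrite integral_cst// mul1e.
Qed.

HB.instance Definition _ (t : R) (t0 : 0 <= t) := Measure.on (evolved t0).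
HB.instance Definition _ (t : R) (t0 : 0 <= t) :=
  Measure_isProbability.Build _ _ _ (evolved t0) (evolvedT t0).

Let evolved_quadrant (t : R) (t0 : 0 <= t) : evolved t0 quadrant = 1%E.
Proof.
have [nu1 _ _] := nuP; rewrite -[RHS]nu1.
rewrite /evolved /mixture (eq_integral (cst 1%E)).
  by rewrite integral_cst// mul1e.
move=> z _; rewrite -(probability_setT (P z)); congr (P z _).
by apply/seteqP; split => w // _; exact: (mjp_state XY_process).
Qed.

(** Duality integrated against [nu]; the dual side is a finite sum over the level of [p], so it
    passes through the integral term by term. *)
Lemma integral_evolved (t : R) (t0 : 0 <= t) p :
  (\int[evolved t0]_(z in quadrant) (Dfun p z)%:E =
   (dtrans t (Dtransform nu) p)%:E)%E.
Proof.
have mD q : measurable_fun quadrant (EFin \o (Dfun q : R * R -> R)).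
  by apply/measurable_EFinP/measurable_funTS; exact: measurable_Dfun.
have Np : levelset (p.1 + p.2) p by [].
set N := (p.1 + p.2)%N in Np.
rewrite integral_mkcond integral_mixture//; last 2 first.
- by move=> z; apply: erestrict_ge0 => x Sx; rewrite lee_fin Dfun_ge0.
- by apply: (measurable_restrictT _ mS).1; exact: (mD p).
have M0 (i : 'I_N.+1) : 0 <= dtrans t \1_[set level N i] p.
  by apply: (trans_ge0 NM_process).
rewrite (eq_integral (fun z => \sum_(i < N.+1) (dtrans t \1_[set level N i] p)%:E *
    (Dfun (level N i) z)%:E)%E); last first.
  move=> z /set_mem Sz; rewrite (integral_law mS XY_process)//; last 2 first.
  - exact: (mD p).
  - by move=> x Sx; rewrite lee_fin Dfun_ge0.
  rewrite (duality XY_process NM_process)// (dual_trans_level NM_process _ t0 Np).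
  by rewrite -sumEFin; apply: eq_bigr => i _; rewrite mulrC.
rewrite ge0_integral_sum//; last 2 first.
- by move=> i; apply: measurable_funeM; exact: mD.
- by move=> i z Sz; rewrite mule_ge0// lee_fin// Dfun_ge0.
rewrite (dual_trans_level NM_process _ t0 Np) -sumEFin; apply: eq_bigr => i _.
rewrite ge0_integralZl_EFin//; last 2 first.
- by move=> z Sz; rewrite lee_fin Dfun_ge0.
- exact: mD.
by rewrite EFin_Dtransform// -EFinM mulrC.
Qed.

(** Invariance makes the evolved law equal to [nu], hence their transforms. Conversely, harmonicity
    equates all moments of the two, and determinacy equates the measures. *)
Lemma invariant_harmonic :
  invariant_measure quadrant P XY nu <-> harmonic setT Phat NM (Dtransform nu).
Proof.
have expE t p : 0 <= t -> ('E_(Phat p)[fun w => Dtransform nu (NM t w)] =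
    (dtrans t (Dtransform nu) p)%:E)%E.
  move=> t0; have Np : levelset (p.1 + p.2) p by [].
  by rewrite unlock (integral_dual NM_process _ t0 Np) (dual_trans_level NM_process _ t0 Np).
split=> [inv p t _ t0|harm t A t0 mA].
- have t0' := ltW t0.
  rewrite expE// -(integral_evolved t0') -EFin_Dtransform//.
  apply: eq_measure_integral => // A mA _; exact: inv.
- have det := nuP; case: det => _ _ det.
  apply: (det (evolved t0)) => // [|n m]; first exact: evolved_quadrant.
  rewrite !momentE; congr (_ * _)%E; rewrite integral_evolved EFin_Dtransform//.
  (* Harmonicity speaks of t > 0 only; t = 0 is the identity of the dual semigroup. *)
  congr (_%:E); case: (ltgtP t 0) t0 => // [t0 _|-> _].
    by apply: EFin_inj; rewrite -expE ?(ltW t0)// harm.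
  exact: (dual_trans0 NM_process).
Qed.

End invariance.

(** * Translation and scaling of Lebesgue integrals *)

Section lebesgue_affine.
Context {R : realType}.
Local Notation mu := (@lebesgue_measure R).
Local Open Scope ereal_scope.

(** The image of Lebesgue measure under the translation agrees with it on half-open intervals, which
    determine it. Scaling below is treated alike, with the factor [c] on the image measure. *)
Lemma ge0_integral_translation (b : R) (f : R -> \bar R) :
  measurable_fun setT f -> (forall x, 0 <= f x) ->
  \int[mu]_x f (x - b)%R = \int[mu]_x f x.
Proof.
move=> mf f0.
pose phi : measurableTypeR R -> measurableTypeR R := fun x : R => (x - b)%R.
have mphi : measurable_fun setT phi by exact: measurable_funB.
rewrite -[LHS](@ge0_integral_pushforward _ _ _ _ _ _ mphi mu setT f)//.
apply: eq_measure_integral => A mA _; apply/esym.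
apply: (lebesgue_measure_unique (mu := pushforward mu phi)) => // _ [[u v] _ <-].
transitivity (mu `](u + b)%R, (v + b)%R]%classic).
  rewrite !lebesgue_measure_itv/= !lte_fin ltrD2r.
  by case: ifPn => // _; rewrite -!EFinB; congr (_%:E); lra.
apply: (congr1 mu).
by apply/seteqP; split => x /=; rewrite !in_itv/= /phi/= ltrBrDr lerBlDr.
Qed.

Lemma ge0_integral_scale (c : R) (f : R -> \bar R) : (0 < c)%R ->
  measurable_fun setT f -> (forall x, 0 <= f x) ->
  c%:E * \int[mu]_x f (c * x)%R = \int[mu]_x f x.
Proof.
move=> c0 mf f0.
pose phi : measurableTypeR R -> measurableTypeR R := fun x : R => (c * x)%R.
have mphi : measurable_fun setT phi by exact: measurable_funM.
have cE : c = (NngNum (ltW c0))%:num by [].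
rewrite -[X in _ * X = _](@ge0_integral_pushforward _ _ _ _ _ _ mphi mu setT f)//.
rewrite {1}cE -ge0_integral_mscale//.
apply: eq_measure_integral => A mA _; apply/esym.
apply: (lebesgue_measure_unique
  (mu := mscale (NngNum (ltW c0)) (pushforward mu phi))) => // _ [[u v] _ <-].
transitivity (c%:E * mu `](u / c)%R, (v / c)%R]%classic).
  rewrite !lebesgue_measure_itv/= !lte_fin ltr_pM2r ?invr_gt0//.
  case: ifPn => _; last by rewrite mule0.
  by rewrite -!EFinB -EFinM; congr (_%:E); field; rewrite gt_eqF.
apply: (congr1 (fun A => c%:E * mu A)).
by apply/seteqP; split => x /=; rewrite !in_itv/= /phi/= ltr_pdivrMr// ler_pdivlMr// mulrC.
Qed.

End lebesgue_affine.

(** * Splitting a Gamma variable of shape 2 into two exponential ones *)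

Section gamma_split.
Context {R : realType}.
Local Notation mu := (@lebesgue_measure R).
Variable theta : R.
Hypothesis theta0 : 0 < theta.

Definition gamma2_pdf : R -> R :=
  (fun x => theta ^- 2 * x * expR (- (x / theta))) \_ `[0, +oo[.

Local Notation w := gamma2_pdf.
Local Notation e := (exponential_pdf theta^-1).

Let e_ge0 x : 0 <= e x.
Proof. by rewrite exponential_pdf_ge0// invr_ge0 ltW. Qed.

Lemma gamma2_pdf_ge0 x : 0 <= w x.
Proof.
rewrite /gamma2_pdf patchE; case: ifPn => // /set_mem/=.
by rewrite in_itv/= andbT => x0; rewrite !mulr_ge0 ?expR_ge0// invr_ge0 sqr_ge0.
Qed.

Lemma measurable_gamma2_pdf : measurable_fun setT w.
Proof.
apply/(measurable_restrictT _ _).1; first exact: measurable_itv.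
apply: measurable_funTS; apply: measurable_funM; first exact: measurable_funM.
apply: measurableT_comp; first exact: measurable_expR.
by apply: measurableT_comp => //; exact: measurable_funM.
Qed.

Let me : measurable_fun setT e. Proof. exact: measurable_exponential_pdf. Qed.

Let e_conv x b : 0 <= b <= x ->
  e (x - b) * e b = theta ^- 2 * expR (- (x / theta)).
Proof.
move=> /andP[b0 bx]; rewrite !exponential_pdfE ?subr_ge0// mulrACA -expRD.
by congr (_ * expR _); rewrite ?expr2 ?invfM//; ring.
Qed.

Let e_conv0 x b : ~~ (0 <= b <= x) -> e (x - b) * e b = 0.
Proof.
rewrite negb_and -!ltNge => /orP[b0|xb].
  by rewrite (lt0_exponential_pdf _ b0) mulr0.
by rewrite lt0_exponential_pdf ?mul0r// subr_lt0.
Qed.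

Section split.
Variable h : R * R -> \bar R.
Hypothesis mh : measurable_fun setT h.
Hypothesis h0 : forall p, (0 <= h p)%E.

(* For b in [0, x] the product e (x - b) * e b does not depend on b. *)
Let convolution x : ((w x)%:E * \int[mu]_(u in `[0%R, 1%R]) h (x * (1 - u), x * u)%R =
  \int[mu]_b ((e (x - b) * e b)%:E * h (x - b, b)%R))%E.
Proof.
have [x0|x0|->] := ltgtP x 0.
- rewrite /w patchE memNset ?mul0e; last by rewrite /= in_itv/= andbT leNgt x0.
  rewrite integral0_eq// => b _; rewrite e_conv0 ?mul0e//.
  by apply/negP => /andP[b0 bx]; have := le_lt_trans (le_trans b0 bx) x0; rewrite ltxx.
(* Substitution b = x u; its Jacobian is the factor x of the Gamma density. *)
- rewrite -(ge0_integral_scale x0)/=; last 2 first.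
  + apply: emeasurable_funM.
      apply/measurable_EFinP; apply: measurable_funM => //.
      by apply: measurableT_comp => //; exact: measurable_funB.
    by apply: measurableT_comp => //; apply/measurable_fun_pair => //; exact: measurable_funB.
  + by move=> b; rewrite mule_ge0// lee_fin mulr_ge0.
  rewrite integral_mkcond.
  have mhx : measurable_fun setT (fun u : R => h (x * (1 - u), x * u)%R).
    by apply: measurableT_comp => //; apply/measurable_fun_pair => //;
      apply: measurable_funM => //; exact: measurable_funB.
  transitivity (x%:E * \int[mu]_u ((theta ^- 2 * expR (- (x / theta)))%:E *
      ((fun u : R => h (x * (1 - u), x * u)%R) \_ `[0%R, 1%R]) u))%E; last first.
    congr (_ * _)%E; apply: eq_integral.
    move=> u _; rewrite patchE; case: ifPn => [/set_mem/=|] u01; apply/esym.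
      move: u01; rewrite in_itv/= => /andP[u0 u1].
      rewrite e_conv; first by rewrite mulrBr mulr1.
      by rewrite mulr_ge0 ?(ltW x0)//= -[leRHS]mulr1 ler_pM2l.
    rewrite e_conv0 ?mul0e ?mule0//; apply: contra u01 => /andP[xu0 xux].
    apply/mem_set; rewrite /= in_itv/=; apply/andP; split.
      by rewrite -(pmulr_rge0 _ x0).
    by rewrite -(ler_pM2l x0) mulr1.
  rewrite ge0_integralZl_EFin//.
  + rewrite muleA -EFinM; congr (_%:E * _)%E.
    rewrite /w patchE mem_set; last by rewrite /= in_itv/= andbT ltW.
    by ring.
  + by move=> u _; exact: erestrict_ge0.
  + by apply/(measurable_restrictT _ _).1 => //; exact: measurable_funTS.
  + by rewrite mulr_ge0 ?expR_ge0// invr_ge0 sqr_ge0.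
- rewrite /w patchE mem_set ?mulr0 ?mul0r ?mul0e; last by rewrite /= in_itv/= lexx.
  (* At x = 0 the integrand lives on the null set {0}, and the Gamma density vanishes. *)
  transitivity (\int[mu]_(b in [set 0%R]) ((e (0 - b) * e b)%:E * h (0 - b, b)%R))%E.
    by rewrite integral_set1.
  rewrite integral_mkcond; apply: eq_integral => b _; rewrite patchE.
  case: ifPn => // b0; rewrite e_conv0 ?mul0e//; apply: contra b0 => /andP[b0 b0'].
  by apply/mem_set => /=; apply/le_anti; rewrite b0 b0'.
Qed.

Let measurable_ee : measurable_fun setT
  (fun p : R * R => (e p.1 * e p.2)%:E * h p)%E.
Proof.
apply: emeasurable_funM => //; apply/measurable_EFinP.
by apply: measurable_funM; exact: measurableT_comp.
Qed.

Let ee_ge0 (p : R * R) : (0 <= (e p.1 * e p.2)%:E * h p)%E.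
Proof. by rewrite mule_ge0// lee_fin mulr_ge0. Qed.

(** Integrate [convolution] over x. The shear a = x - b is carried out by swapping the integrals,
    translating x by b, and swapping back. *)
Lemma integral_gamma2_pdf_split :
  (\int[mu]_x ((w x)%:E * \int[mu]_(u in `[0%R, 1%R]) h (x * (1 - u), x * u)%R) =
   \int[mu]_a \int[mu]_b ((e a * e b)%:E * h (a, b)))%E.
Proof.
under eq_integral do rewrite convolution.
pose sh (p : R * R) : R * R := (p.1 - p.2, p.2).
have msh : measurable_fun setT sh.
  apply/measurable_fun_pair; last exact: measurable_snd.
  by apply: measurable_funB; [exact: measurable_fst|exact: measurable_snd].
transitivity (\int[mu]_b \int[mu]_x ((e (x - b) * e b)%:E * h (x - b, b)%R))%E.
  apply: (@fubini_tonelli _ _ (measurableTypeR R) (measurableTypeR R) R mu mu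
    (fun p : R * R => (e (sh p).1 * e (sh p).2)%:E * h (sh p))%E).
    exact: measurableT_comp measurable_ee msh.
  by move=> p; exact: (ee_ge0 (sh p)).
transitivity (\int[mu]_b \int[mu]_a ((e a * e b)%:E * h (a, b)))%E.
  apply: eq_integral => b _.
  apply: (ge0_integral_translation b (f := fun a => ((e a * e b)%:E * h (a, b))%E)).
    by apply: (measurableT_comp measurable_ee (pair2_measurable b)).
  by move=> a; exact: (ee_ge0 (a, b)).
apply/esym/(@fubini_tonelli _ _ (measurableTypeR R) (measurableTypeR R) R mu mu
    (fun p : R * R => (e p.1 * e p.2)%:E * h p)%E) => //.
Qed.

End split.

(** The case h = 1 of the splitting identity reduces the mass to that of two exponential laws. *)
Lemma integral_gamma2_pdf : (\int[mu]_x (w x)%:E = 1)%E.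
Proof.
have := @integral_gamma2_pdf_split (cst 1%E) (measurable_cst _) (fun=> lee01).
set I := (I in I = _ -> _); have -> : I = (\int[mu]_x (w x)%:E)%E.
  apply: eq_integral => x _; rewrite integral_cst//= lebesgue_measure_itv/= lte01 sube0.
  by rewrite !mule1.
move=> ->; rewrite -[RHS](integral_exponential_pdf (rate := theta^-1)) ?invr_gt0//.
apply: eq_integral => a _.
transitivity (\int[mu]_b ((e a)%:E * (e b)%:E))%E.
  by apply: eq_integral => b _; rewrite mule1 EFinM.
rewrite ge0_integralZl_EFin//.
- by rewrite integral_exponential_pdf ?invr_gt0// mule1.
- by move=> b _; rewrite lee_fin.
- exact/measurable_EFinP.
Qed.

End gamma_split.

(** * Probability measures given by a density *)

Section density.
Context {R : realType}.
Local Notation mu := (@lebesgue_measure R).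
Variable w : R -> R.

(** Scaling a measure takes a nonnegative number, whence the absolute value; [integral_density]
    removes it by [w0]. *)
Let atom (x : R) : {measure set R -> \bar R} := mscale (`|w x|%:nng)%R \d_x.

Lemma measurable_atom : measurable_fun setT w ->
  forall A, measurable A -> measurable_fun setT (fun x => atom x A).
Proof.
move=> mw A mA; rewrite /atom /mscale/=.
apply: emeasurable_funM.
  by apply/measurable_EFinP; exact: measurableT_comp.
by apply/measurable_EFinP; exact: measurable_indic.
Qed.

(* Presented as a mixture of Dirac masses so that integral_mixture computes its integrals. *)
Definition density (mw : measurable_fun setT w) (w0 : forall x, 0 <= w x)
    (w1 : (\int[mu]_x (w x)%:E = 1)%E) : set R -> \bar R :=
  mixture mu measurableT (measurable_atom mw).

Variables (mw : measurable_fun setT w) (w0 : forall x, 0 <= w x).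
Hypothesis w1 : (\int[mu]_x (w x)%:E = 1)%E.

HB.instance Definition _ := Measure.on (density mw w0 w1).

Lemma integral_density (f : R -> \bar R) : measurable_fun setT f ->
  (forall x, (0 <= f x)%E) ->
  (\int[density mw w0 w1]_x f x = \int[mu]_x ((w x)%:E * f x))%E.
Proof.
move=> mf f0; rewrite integral_mixture//; apply: eq_integral => x _.
rewrite ge0_integral_mscale//= integral_dirac// diracT mul1e.
by rewrite ger0_norm.
Qed.

Let densityT : density mw w0 w1 setT = 1%E.
Proof.
rewrite -[LHS]mul1e -(integral_cst _ measurableT) integral_density//.
by rewrite -[RHS]w1; apply: eq_integral => x _; rewrite mule1.
Qed.

HB.instance Definition _ :=
  Measure_isProbability.Build _ _ _ (density mw w0 w1) densityT.

End density.

(** * Iterated integrals *)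

Ltac measurable_coords := rewrite /=;
  repeat (apply: measurable_funD || apply: measurable_funB || apply: measurable_funM);
  rewrite //; repeat (apply: measurableT_comp; rewrite //).

Ltac measurable_at := apply: measurableT_comp; rewrite //;
  apply/measurable_fun_pair; measurable_coords.

Lemma swap_integrals d1 d2 (T1 : measurableType d1) (T2 : measurableType d2)
    (R : realType) (m1 : {sigma_finite_measure set T1 -> \bar R})
    (m2 : {sigma_finite_measure set T2 -> \bar R}) (f : T1 -> T2 -> \bar R) :
  measurable_fun setT (fun p => f p.1 p.2) -> (forall x y, (0 <= f x y)%E) ->
  (\int[m1]_x \int[m2]_y f x y = \int[m2]_y \int[m1]_x f x y)%E.
Proof.
by move=> mf f0; apply: (@fubini_tonelli _ _ _ _ _ m1 m2 (fun p => f p.1 p.2)).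
Qed.

Lemma measurable_integral d1 d2 (T1 : measurableType d1) (T2 : measurableType d2)
    (R : realType) (m : {sigma_finite_measure set T2 -> \bar R})
    (f : T1 -> T2 -> \bar R) :
  measurable_fun setT (fun p => f p.1 p.2) -> (forall x y, (0 <= f x y)%E) ->
  measurable_fun setT (fun x => \int[m]_y f x y)%E.
Proof.
move=> mf f0.
by apply: (@measurable_fun_fubini_tonelli_F _ _ _ _ _ m (fun p => f p.1 p.2)).
Qed.

(** * Stationarity of a product law under one exchange *)

Section stationary_product.
Context {R : realType}.
Variables g e u01 : probability R R.
Local Open Scope ereal_scope.

Hypothesis split : forall h : R * R -> \bar R, measurable_fun setT h ->
  (forall p, 0 <= h p) ->
  \int[g]_x \int[u01]_u h (x * (1 - u), x * u)%R = \int[e]_a \int[e]_b h (a, b).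

(** Applied to a function of the sum, [split] forgets u, since x (1 - u) + x u = x. *)
Let convolution (k : R -> \bar R) : measurable_fun setT k ->
  (forall x, 0 <= k x) -> \int[e]_a \int[e]_b k (a + b)%R = \int[g]_x k x.
Proof.
move=> mk k0; rewrite -(@split (fun p => k (p.1 + p.2)%R))//=; last first.
  by apply: measurableT_comp => //; measurable_coords.
apply: eq_integral => x _; rewrite -[RHS]mule1 -(probability_setT u01).
rewrite -(integral_cst _ measurableT).
by apply: eq_integral => u _; congr (k _); rewrite -mulrDr subrK mulr1.
Qed.

(** By [split], x becomes a = x (1 - u), b = x u and y becomes p = y (1 - v), r = y v. The exchange
    returns (a + r, b + p), and [convolution] recombines each sum into [g]. *)
Lemma stationary_exchange (F : R * R -> \bar R) : measurable_fun setT F ->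
  (forall p, 0 <= F p) ->
  \int[g]_x \int[g]_y \int[u01]_v \int[u01]_u F (exchange (x, y) v u) =
  \int[g]_x \int[g]_y F (x, y).
Proof.
move=> mF F0; rewrite /exchange/=.
(* Each variable is brought next to its own uniform variable, so that [split] applies twice. *)
transitivity (\int[g]_x \int[u01]_u \int[g]_y \int[u01]_v
    F (x * (1 - u) + y * v, y * (1 - v) + x * u)%R).
  apply: eq_integral => x _.
  transitivity (\int[g]_y \int[u01]_u \int[u01]_v
      F (x * (1 - u) + y * v, y * (1 - v) + x * u)%R).
    apply: eq_integral => y _.
    apply: (@swap_integrals _ _ _ _ _ u01 u01
      (fun v u => F (x * (1 - u) + y * v, y * (1 - v) + x * u)%R)) => //.
    by measurable_at.
  apply: (@swap_integrals _ _ _ _ _ g u01 (fun y u => \int[u01]_v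
    F (x * (1 - u) + y * v, y * (1 - v) + x * u)%R)).
    apply: measurable_integral => //; by measurable_at.
  by move=> y u; exact: integral_ge0.
pose H (q : R * R) := \int[e]_p \int[e]_r F (q.1 + r, q.2 + p)%R.
have mH : measurable_fun setT H.
  do 2 (apply: measurable_integral; last by move=> *; rewrite ?integral_ge0).
  by measurable_at.
have H0 q : 0 <= H q by apply: integral_ge0 => p _; exact: integral_ge0.
transitivity (\int[g]_x \int[u01]_u H (x * (1 - u), x * u)%R).
  apply: eq_integral => x _; apply: eq_integral => u _ /=.
  transitivity (\int[g]_y \int[u01]_v
      F (x * (1 - u) + y * v, x * u + y * (1 - v))%R).
    by apply: eq_integral => y _; apply: eq_integral => v _;
      rewrite [(x * u + _)%R]addrC.
  apply: (@split (fun q => F (x * (1 - u) + q.2, x * u + q.1)%R)) => //.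
  by measurable_at.
transitivity (\int[e]_a \int[e]_b H (a, b)); first exact: split.
rewrite -(@convolution (fun x => \int[g]_y F (x, y))); last 2 first.
- apply: measurable_integral => //; by measurable_at.
- by move=> x; exact: integral_ge0.
apply: eq_integral => a _ /=.
(* The order a, b, p, r is changed to a, r, b, p, which puts the summands of each coordinate side by
   side. *)
transitivity (\int[e]_b \int[e]_r \int[e]_p F (a + r, b + p)%R).
  apply: eq_integral => b _.
  apply: (@swap_integrals _ _ _ _ _ e e (fun p r => F (a + r, b + p)%R)) => //.
  by measurable_at.
transitivity (\int[e]_r \int[e]_b \int[e]_p F (a + r, b + p)%R).
  apply: (@swap_integrals _ _ _ _ _ e e (fun b r => \int[e]_p F (a + r, b + p)%R)).
    apply: measurable_integral => //; by measurable_at.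
  by move=> b r; exact: integral_ge0.
apply: eq_integral => r _.
by rewrite (@convolution (fun y => F (a + r, y)%R))//; measurable_at.
Qed.

End stationary_product.

(** * Stationarity of the Gamma product *)

Section stationarity.
Context {R : realType}.
Local Notation mu := (@lebesgue_measure R).
Variable theta : R.
Hypothesis theta0 : 0 < theta.

(** Carries the probability structure that the bare set function [gamma2] lacks; [gamma2_probE]
    identifies the two. *)
Definition gamma2_prob : probability R R :=
  density (measurable_gamma2_pdf theta) (gamma2_pdf_ge0 theta)
    (integral_gamma2_pdf theta0).

Let rate0 : 0 < theta^-1. Proof. by rewrite invr_gt0. Qed.

Let exponential : probability R R :=
  density (measurable_exponential_pdf theta^-1) (exponential_pdf_ge0 (ltW rate0))
    (integral_exponential_pdf rate0).

Let indic01_ge0 (x : R) : 0 <= \1_`[0, 1] x :> R.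
Proof. by []. Qed.

Let measurable_indic01 : measurable_fun setT (\1_`[0, 1] : R -> R).
Proof. exact: measurable_indic. Qed.

Let integral_indic01 : (\int[mu]_x (\1_`[0, 1] x)%:E = 1)%E.
Proof. by rewrite integral_indic// setIT [LHS]lebesgue_measure_itv/= lte01 sube0. Qed.

Let uniform01 : probability R R :=
  density measurable_indic01 indic01_ge0 integral_indic01.

Let integral_uniform01 (f : R -> \bar R) : measurable_fun setT f ->
  (forall x, (0 <= f x)%E) ->
  (\int[uniform01]_x f x = \int[mu]_(x in `[0%R, 1%R]) f x)%E.
Proof.
move=> mf f0; rewrite integral_density// [RHS]integral_mkcond.
apply: eq_integral => x _; rewrite patchE indicE.
by case: ifPn => _; rewrite ?mul1e ?mul0e.
Qed.

Lemma gamma2_probE : gamma2 theta = gamma2_prob :> (set R -> \bar R).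
Proof.
apply/funext => A; rewrite /gamma2 /gamma2_prob/= /density /mixture.
rewrite [LHS]integral_mkcond; apply: eq_integral => x _.
rewrite -[RHS]/((`|gamma2_pdf theta x|)%:E * (\1_A x)%:E)%E.
rewrite ger0_norm ?gamma2_pdf_ge0// /gamma2_pdf !patchE indicE in_setI.
by case: (x \in A); case: (x \in `[0, +oo[%classic); rewrite /= ?mule1 ?mule0 ?mul0e.
Qed.

Section split.
Variable h : R * R -> \bar R.
Hypothesis mh : measurable_fun setT h.
Hypothesis h0 : forall p, (0 <= h p)%E.

Lemma gamma2_prob_split : (\int[gamma2_prob]_x \int[uniform01]_u h (x * (1 - u), x * u)%R =
  \int[exponential]_a \int[exponential]_b h (a, b))%E.
Proof.
rewrite [LHS]integral_density; last 2 first.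
- by apply: measurable_integral => //; measurable_at.
- by move=> x; exact: integral_ge0.
rewrite [RHS]integral_density; last 2 first.
- by apply: measurable_integral => //; measurable_at.
- by move=> x; exact: integral_ge0.
transitivity (\int[mu]_x ((gamma2_pdf theta x)%:E *
    \int[mu]_(u in `[0%R, 1%R]) h (x * (1 - u), x * u)%R))%E.
  apply: eq_integral => x _; rewrite integral_uniform01//; by measurable_at.
rewrite integral_gamma2_pdf_split//; apply: eq_integral => a _.
rewrite integral_density//; last by measurable_at.
rewrite -ge0_integralZl_EFin//.
- by apply: eq_integral => b _; rewrite EFinM muleA.
- by move=> b _; rewrite mule_ge0// lee_fin exponential_pdf_ge0// ltW.
- apply: emeasurable_funM; last by measurable_at.
  by apply/measurable_EFinP; exact: measurable_exponential_pdf.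
- by rewrite exponential_pdf_ge0// ltW.
Qed.
End split.

Lemma gamma2_prob_itv : gamma2_prob `[0%R, +oo[%classic = 1%E.
Proof.
rewrite -(probability_setT gamma2_prob) -gamma2_probE /gamma2.
by rewrite setIid setTI.
Qed.

Local Notation nu := (gamma2_prob \x gamma2_prob)%E.

Lemma gamma2_prob_quadrant : nu quadrant = 1%E.
Proof.
rewrite (_ : quadrant = `[0, +oo[ `*` `[0, +oo[); last first.
  by apply/seteqP; split => -[x y] /=; rewrite !in_itv/= !andbT.
rewrite product_measure1E; [|exact: measurable_itv..].
by rewrite -[RHS]mule1; congr (_ * _)%E; exact: gamma2_prob_itv.
Qed.

(** This is [stationary_exchange] for [f] extended by 0; the quadrant has full mass, so integrals
    over it and over the plane coincide. *)
Lemma redistribute_gamma2 (f : R * R -> R) : bounded_measurable quadrant f ->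
  (forall z, quadrant z -> 0 <= f z) ->
  (\int[nu]_(z in quadrant) (redistribute f z)%:E =
   \int[nu]_(z in quadrant) (f z)%:E)%E.
Proof.
move=> bf f0; have mS := @measurable_quadrant R.
pose F := (EFin \o f) \_ quadrant.
have mF : measurable_fun setT F.
  by apply/(measurable_restrictT _ mS); apply/measurable_EFinP; case: bf.
have F0 z : (0 <= F z)%E by apply: erestrict_ge0 => x Sx; rewrite lee_fin f0.
pose G (z : R * R) := (\int[uniform01]_v \int[uniform01]_u F (exchange z v u))%E.
have mFe : measurable_fun setT (fun p : (R * R) * R * R => F (exchange p.1.1 p.1.2 p.2)).
  exact: measurableT_comp mF (measurable_exchange (R := R)).
have mG : measurable_fun setT G.
  by do 2 (apply: measurable_integral; last by move=> *; rewrite ?integral_ge0).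
have G0 z : (0 <= G z)%E by apply: integral_ge0 => v _; exact: integral_ge0.
transitivity (\int[nu]_(z in quadrant) G z)%E.
  apply: eq_integral => z /set_mem Sz; rewrite EFin_redistribute//.
  rewrite /G [RHS]integral_uniform01; last 2 first.
  - apply: measurable_integral => //.
    have mz : measurable_fun setT (fun p : R * R => (z, p.1, p.2)).
      by do 2 apply/measurable_fun_pair => //.
    exact: measurableT_comp mFe mz.
  - by move=> v; exact: integral_ge0.
  apply: eq_integral => v _; rewrite [RHS]integral_uniform01//.
  exact: (measurableT_comp mFe (pair1_measurable (z, v))).
transitivity (\int[nu]_z G z)%E.
  rewrite [RHS](@ge0_negligible_integral _ _ _ _ _ (~` quadrant))//.
  - by rewrite setTD setCK.
  - exact: measurableC.
  - exact: probability_setC_eq0 gamma2_prob_quadrant.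
rewrite [LHS](fubini_tonelli1 (m1 := gamma2_prob) (m2 := gamma2_prob))//.
rewrite [LHS](stationary_exchange (e := exponential) (@gamma2_prob_split))//.
by rewrite -[LHS](fubini_tonelli1 (m1 := gamma2_prob) (m2 := gamma2_prob))// -integral_mkcond.
Qed.

End stationarity.

(** * From stationarity under one exchange to invariance *)

Section stationary_invariant.
Context {R : realType} {d : measure_display} {Omega : measurableType d}.
Variables (P : R * R -> probability Omega R) (XY : R -> Omega -> R * R).
Hypothesis XY_process : markov_jump_process quadrant P XY genL.
Local Notation quadrant := (@quadrant R).
Local Notation T := (trans P XY).
Local Notation bm := (bounded_measurable quadrant).

Let mS := @measurable_quadrant R.

(** On the quadrant [genL f] is a difference of bounded measurable functions, so T_s distributes
    over the one-step remainder. *)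
Let trans_increment f s h z : bm f -> (forall x, quadrant x -> 0 <= f x) ->
  0 <= s -> 0 <= h -> quadrant z ->
  T s (fun x => T h f x - f x - h * genL f x) z =
  T (s + h) f z - T s f z - h * (T s (redistribute f) z - T s f z).
Proof.
move=> bf f0 s0 h0 Sz.
have bK : bm (redistribute f) by exact: bounded_measurable_redistribute.
have bTh : bm (T h f) by exact: (bounded_measurable_trans mS XY_process).
rewrite (eq_trans XY_process (g := fun x => T h f x - f x
  - h * (redistribute f x - f x)) _ s0); last by move=> x Sx; rewrite genLE.
rewrite (transB mS XY_process)//; last 2 first.
- exact: bounded_measurableB.
- by apply: bounded_measurableZ; exact: bounded_measurableB.
rewrite (transB mS XY_process)// (transZ mS XY_process)//; last exact: bounded_measurableB.
by rewrite (transB mS XY_process)// -(trans_semigroup mS XY_process).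
Qed.

Let trans_increment_le f s h z e : bm f -> (forall x, quadrant x -> 0 <= f x) ->
  0 <= s -> 0 <= h -> quadrant z ->
  (forall x, quadrant x -> `|T h f x - f x - h * genL f x| <= e) ->
  `|T (s + h) f z - T s f z - h * (T s (redistribute f) z - T s f z)| <= e.
Proof.
move=> bf f0 s0 h0 Sz He; rewrite -trans_increment//.
apply: (trans_norm_le mS XY_process) => //.
have bK : bm (redistribute f) by exact: bounded_measurable_redistribute.
have [mf [M fM]] : bm (fun x => T h f x - f x - h * (redistribute f x - f x)).
  apply: bounded_measurableB.
    by apply: bounded_measurableB => //; exact: (bounded_measurable_trans mS XY_process).
  by apply: bounded_measurableZ; exact: bounded_measurableB.
split; last by exists M => x Sx; rewrite genLE//; exact: fM.
by apply: eq_measurable_fun mf => x /set_mem Sx; rewrite genLE.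
Qed.

(* Both sides are the uniform limit of T_s f + (T_(s + h) f - T_s f) / h as h -> 0. *)
Lemma trans_redistribute f s z : bm f -> (forall x, quadrant x -> 0 <= f x) ->
  0 <= s -> quadrant z -> T s (redistribute f) z = redistribute (T s f) z.
Proof.
move=> bf f0 s0 Sz.
have bK : bm (redistribute f) by exact: bounded_measurable_redistribute.
have bT : bm (T s f) by exact: (bounded_measurable_trans mS XY_process).
have T0 x : quadrant x -> 0 <= T s f x by move=> _; exact: (trans_ge0 XY_process).
apply/eqP; rewrite -subr_eq0 -normr_eq0 eq_le normr_ge0 andbT.
apply/ler_addgt0Pl => eps eps0; rewrite addr0.
have e20 : 0 < eps / 2 by rewrite divr_gt0.
(* One h serves both expansions: of T_h f, to which T_s is then applied, and of T_h at T_s f. Both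
   describe T_(s + h) f. *)
have [h [[h0 H1] [_ H2]]] := filter_ex (filterI
  (trans_generator XY_process bf e20) (trans_generator XY_process bT e20)).
have := trans_increment_le bf f0 s0 (ltW h0) Sz H1.
have := H2 _ Sz; rewrite genLE//.
have -> : T (s + h) f z = T h (T s f) z.
  by rewrite addrC; exact: (trans_semigroup mS XY_process Sz (ltW h0) s0 bf).
move: (T h (T s f) z) (T s f z) (T s (redistribute f) z) (redistribute _ z) => a b k l.
move=> A1 A2; rewrite -(ler_pM2l h0) -[X in X * `|_| <= _](gtr0_norm h0) -normrM.
move: A1 A2; rewrite !mulrBr [h * eps](_ : _ = h * (eps / 2) + h * (eps / 2)); last by field.
move: (h * b) (h * k) (h * l) (h * (eps / 2)) => hb hk hl e.
by rewrite !ler_norml => /andP[? ?] /andP[? ?]; apply/andP; split; lra.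
Qed.

Variable nu : probability (R * R)%type R.
Hypothesis nuS : nu quadrant = 1%E.
Hypothesis nuK : forall f, bm f -> (forall z, quadrant z -> 0 <= f z) ->
  (\int[nu]_(z in quadrant) (redistribute f z)%:E =
   \int[nu]_(z in quadrant) (f z)%:E)%E.

Let integrable_nu f : bm f -> nu.-integrable quadrant (EFin \o f).
Proof.
move=> bf; apply: measurable_bounded_integrable => //.
- by rewrite [ltLHS]nuS ltry.
- by case: bf.
- exact: bounded_measurable_bounded bf.
Qed.

(** For phi(s) = nu T_s 1_A, stationarity kills nu (K - 1) T_s 1_A, so the increment of phi is the
    integral of the remainder [r]. Commutation of K with T_s turns [r] into T_s of the one-step
    error for 1_A, which is o(h) uniformly in s. *)
Lemma stationary_invariant : invariant_measure quadrant P XY nu.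
Proof.
move=> t A t0 mA.
have bA : bm (\1_A : R * R -> R) by exact: bounded_measurable_indic.
have A0 (x : R * R) : quadrant x -> 0 <= \1_A x :> R by [].
have bT s : 0 <= s -> bm (T s \1_A) by move=> s0; exact: (bounded_measurable_trans mS XY_process).
pose phi s := \int[nu]_(z in quadrant) T s \1_A z.
have EFin_phi s : 0 <= s -> (phi s)%:E = (\int[nu]_(z in quadrant) (T s \1_A z)%:E)%E.
  by move=> s0; rewrite fineK//; apply: integrable_fin_num => //; exact/integrable_nu/bT.
transitivity (phi t)%:E.
  rewrite EFin_phi//; apply: eq_integral => z _; rewrite (EFin_trans mS XY_process)//.
  by rewrite integral_indic ?setIT//; exact: (measurable_process XY_process).
have -> : phi t = phi 0.
  apply: eq_of_small_increments => // eps eps0; near=> h.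
  have [h0 H] : 0 < h /\ forall z, quadrant z ->
      `|T h \1_A z - \1_A z - h * genL \1_A z| <= h * eps.
    by near: h; exact: (trans_generator XY_process bA eps0).
  move=> s s0 _; have sh0 : 0 <= s + h by rewrite addr_ge0 ?(ltW h0).
  have bK := bounded_measurable_redistribute (bT _ s0) (fun x _ => trans_ge0 XY_process x s0 A0).
  have KT : \int[nu]_(z in quadrant) redistribute (T s \1_A) z = phi s.
    apply: EFin_inj; rewrite EFin_phi// fineK; last first.
      by apply: integrable_fin_num => //; exact: integrable_nu.
    by apply: nuK; [exact: bT|move=> x _; exact: (trans_ge0 XY_process)].
  pose r z := T (s + h) \1_A z - T s \1_A z - h * (redistribute (T s \1_A) z - T s \1_A z).
  have br : bm r.
    apply: bounded_measurableB; first by apply: bounded_measurableB; exact: bT.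
    by apply: bounded_measurableZ; apply: bounded_measurableB => //; exact: bT.
  have re z : quadrant z -> `|r z| <= h * eps.
    move=> Sz; rewrite /r -trans_redistribute//.
    by apply: trans_increment_le => //; exact: ltW.
  have -> : phi (s + h) - phi s = \int[nu]_(z in quadrant) r z.
    rewrite /r RintegralB//; last 2 first.
    - by apply: integrable_nu; apply: bounded_measurableB; exact: bT.
    - apply: integrable_nu; apply: bounded_measurableZ.
      by apply: bounded_measurableB => //; exact: bT.
    rewrite RintegralZl//; last first.
      by apply: integrable_nu; apply: bounded_measurableB => //; exact: bT.
    rewrite !RintegralB//; try by apply: integrable_nu => //; exact: bT.
    by rewrite KT -/(phi s) -/(phi (s + h)) subrr mulr0 subr0.
  rewrite (le_trans (le_normr_Rintegral _ _))//; first exact: integrable_nu.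
  have -> : h * eps = \int[nu]_(z in quadrant) (h * eps).
    by rewrite Rintegral_cst// [X in fine X]nuS mulr1.
  apply: le_Rintegral => //; first exact: (integrable_norm (integrable_nu br)).
  exact: (integrable_nu (bounded_measurable_cst _ _)).
rewrite EFin_phi//.
transitivity (\int[nu]_(z in quadrant) (\1_A z)%:E)%E.
  apply: eq_integral => z /set_mem Sz; rewrite (trans0 mS XY_process)//.
  exact: measurable_pair_set1.
(* The set [A] may leave the quadrant, but only by a null set. *)
rewrite -[in RHS](setIT A) -(integral_indic nu measurableT)//.
rewrite [RHS](@ge0_negligible_integral _ _ _ _ _ (~` quadrant))//.
- by rewrite setTD setCK.
- exact: measurableC.
- by apply/measurable_EFinP; exact: measurable_indic.
- exact: probability_setC_eq0 nuS.
Unshelve. all: end_near. Qed.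

End stationary_invariant.

Theorem theorem2p2 (R : realType) (d d' : measure_display)
    (Omega : measurableType d) (Omega' : measurableType d')
    (P : R * R -> probability Omega R) (XY : R -> Omega -> R * R)
    (Phat : nat * nat -> probability Omega' R) (NM : R -> Omega' -> nat * nat)
    (XY_process : markov_jump_process quadrant P XY genL)
    (NM_process : markov_jump_process setT Phat NM dual_genL) :
  (forall nu : probability (R * R)%type R, Pf nu ->
     invariant_measure quadrant P XY nu <->
     harmonic setT Phat NM (Dtransform nu)) /\
  (forall theta : R, 0 < theta ->
     invariant_measure quadrant P XY (gamma2 theta \x gamma2 theta)%E).
Proof.
split=> [nu nuP|theta theta0]; first exact: invariant_harmonic.
(* Turns the factors of the product into probability measures. *)
rewrite (gamma2_probE theta0).
apply: (stationary_invariant XY_process (gamma2_prob_quadrant theta0)).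
exact: redistribute_gamma2.
Qed.
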